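(* Let $F_{\alpha,\beta}=\{f^n_{\alpha(n),\beta(n)}\}_{n\in\mathbb{N}}$ be a Fučík system and let $\varepsilon>0$ be fixed. Let the mappings $\alpha$ and $\beta$ satisfy $$ \max\left(\sqrt{\alpha(n)},\sqrt{\beta(n)}\right)\le n+\sqrt{c_n}\,n^{(1-\varepsilon)/2} $$ for every $n\ge2$, with non-negative constants $c_n$ such that $$ c_n<\frac{9}{8(3+\pi^2)}\cdot\frac{1}{\zeta(1+\varepsilon)-1}\quad\text{for even } n, $$ $$ c_n<\frac{(n-1)^4}{8n^2(n^2+1)}\cdot\frac{1}{\zeta(1+\varepsilon)-1}\quad\text{for odd } n \text{ with } \alpha(n)\ge\beta(n), $$ $$ c_n<\frac{(n+1)^4}{10n^2(n^2+1)}\cdot\frac{1}{\zeta(1+\varepsilon)-1}\quad\text{for odd } n \text{ with } \beta(n)>\alpha(n), $$ where $\zeta(s)=\sum_{n=1}^\infty \frac{1}{n^s}$ is the Riemann zeta function. Then $F_{\alpha,\beta}$ is a Riesz basis in $L^2(0,\pi)$.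
   Context: Consider the boundary value problem $-u''(x)=\alpha u^+(x)-\beta u^-(x)$ in $(0,\pi)$, $u(0)=u(\pi)=0$, where $u^+=\max(u,0)$, $u^-=\max(-u,0)$, and $\alpha,\beta$ are real parameters. For $\alpha,\beta>0$ define the curves: for even $n\ge 2$, $$\Gamma_n=\Big\{(\alpha,\beta):\ \tfrac{n}{2}\tfrac{\pi}{\sqrt{\alpha}}+\tfrac{n}{2}\tfrac{\pi}{\sqrt{\beta}}=\pi\Big\},$$ and for odd $n\ge 3$, $$\Gamma_n=\Big\{(\alpha,\beta):\ \tfrac{n+1}{2}\tfrac{\pi}{\sqrt{\alpha}}+\tfrac{n-1}{2}\tfrac{\pi}{\sqrt{\beta}}=\pi\Big\}.$$ Normalized Fučík eigenfunction: for $n\ge2$ and $(\alpha,\beta)\in\Gamma_n$, $f^n_{\alpha,\beta}$ is the $C^2$-solution of the boundary value problem $-u''=\alpha u^+-\beta u^-$ in $(0,\pi)$, $u(0)=u(\pi)=0$, with $(f^n_{\alpha,\beta})'(0)>0$ and $\sup_{x\in[0,\pi]}|f^n_{\alpha,\beta}(x)|=1$. Explicitly, with $l_1=\pi/\sqrt{\alpha}$, $l_2=\pi/\sqrt{\beta}$, $l=l_1+l_2$, $k\in\{0,1,2,\dots\}$: if $\alpha\ge n^2\ge\beta$, then $f^n_{\alpha,\beta}(x)=\frac{\sqrt{\beta}}{\sqrt{\alpha}}\sin(\sqrt{\alpha}(x-kl))$ for $kl\le x<kl+l_1$ and $f^n_{\alpha,\beta}(x)=-\sin(\sqrt{\beta}(x-kl-l_1))$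 for $kl+l_1\le x<(k+1)l$; if $\beta>n^2>\alpha$, then $f^n_{\alpha,\beta}(x)=\sin(\sqrt{\alpha}(x-kl))$ for $kl\le x<kl+l_1$ and $f^n_{\alpha,\beta}(x)=-\frac{\sqrt{\alpha}}{\sqrt{\beta}}\sin(\sqrt{\beta}(x-kl-l_1))$ for $kl+l_1\le x<(k+1)l$. For $n=1$, $f^1_{\alpha,\beta}(x)=\sin x$. Fučík system: a sequence $F_{\alpha,\beta}=\{f^n_{\alpha(n),\beta(n)}\}_{n\in\mathbb{N}}$ of normalized Fučík eigenfunctions, where $\alpha,\beta:\mathbb{N}\to\mathbb{R}$ satisfy $\alpha(1)=\beta(1)=1$ and $(\alpha(n),\beta(n))\in\Gamma_n$ for every $n\ge2$. Riesz basis: a system $\{\psi_n\}_{n\in\mathbb{N}}$ in $L^2(0,\pi)$ that is complete (its linear span is dense in $L^2(0,\pi)$) and for which there are constants $c,C>0$ with $c\sum_{n=1}^N|a_n|^2\le\|\sum_{n=1}^N a_n\psi_n\|^2\le C\sum_{n=1}^N|a_n|^2$ for all $N\in\mathbb{N}$ and all scalars $a_1,\dots,a_N$, where $\|\cdot\|$ is the standard norm of $L^2(0,\pi)$. *)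

(* Defs.v *)
From mathcomp Require Import all_boot all_order all_algebra.
From mathcomp Require Import all_classical all_reals all_analysis.

Set Implicit Arguments.
Unset Strict Implicit.
Unset Printing Implicit Defensive.

Import Order.TTheory GRing.Theory Num.Theory.
Import numFieldNormedType.Exports.

Local Open Scope classical_set_scope.
Local Open Scope ring_scope.

(* Riemann zeta function for real s > 1; [riemannR s n] is 1 / (n+1)^s. *)
Definition zeta (R : realType) (s : R) : R := limn (series (riemannR s)).

(* Derivative of f at x relative to A: for A a closed interval this is the
   one-sided derivative at each endpoint, and the values of f outside A are
   irrelevant. *)
Definition has_derivative_in (R : realType) (A : set R) (f : R -> R)
    (x l : R) : Prop :=
  (f y - f x) / (y - x) @[y --> within A x^'] --> l.

(* u is of class C^2 on A, with first derivative u1 and second derivative u2. *)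
Definition C2_in (R : realType) (A : set R) (u u1 u2 : R -> R) : Prop :=
  [/\ forall x, A x -> has_derivative_in A u x (u1 x),
      forall x, A x -> has_derivative_in A u1 x (u2 x) &
      {within A, continuous u2}].

(* - u'' = alpha u^+ - beta u^- in (0, pi), u(0) = u(pi) = 0. *)
Definition fucik_bvp (R : realType) (alpha beta : R) (u u2 : R -> R) : Prop :=
  [/\ forall x, x \in `]0, pi[ ->
        - u2 x = alpha * Num.max (u x) 0 - beta * Num.max (- u x) 0,
      u 0 = 0 & u pi = 0].

Definition fucik_curve (R : realType) (n : nat) : set (R * R) :=
  [set ab | [/\ 0 < ab.1, 0 < ab.2 &
    if odd n then
      n.+1%:R / 2 * (pi / Num.sqrt ab.1) + n.-1%:R / 2 * (pi / Num.sqrt ab.2)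
        = pi
    else
      n%:R / 2 * (pi / Num.sqrt ab.1) + n%:R / 2 * (pi / Num.sqrt ab.2)
        = pi]].

(* Only the values of f on [0, pi] are constrained; a function on [0, pi] is
   represented by any of its extensions to R. *)
Definition normalized_fucik_eigenfunction (R : realType) (n : nat)
    (alpha beta : R) (f : R -> R) : Prop :=
  if n == 1%N then forall x, x \in `[0, pi] -> f x = sin x
  else exists f1 f2 : R -> R,
    [/\ C2_in `[0, pi] f f1 f2, fucik_bvp alpha beta f f2, 0 < f1 0 &
        sup [set `|f x| | x in `[0, pi]] = 1].

(* Sequences are indexed by n >= 1; the terms of index 0 play no role. *)
Definition fucik_system (R : realType) (alpha beta : nat -> R)
    (f : nat -> R -> R) : Prop :=
  [/\ alpha 1%N = 1, beta 1%N = 1,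
      forall n, (2 <= n)%N -> fucik_curve n (alpha n, beta n) &
      forall n, (1 <= n)%N ->
        normalized_fucik_eigenfunction n (alpha n) (beta n) (f n)].

(* L^2(0, pi) is identified with the functions in L^2(R) that vanish outside
   (0, pi), through extension by zero. *)
Definition in_L2 (R : realType) (g : R -> R) : Prop :=
  (g \_ `]0, pi[) \in Lfun (@lebesgue_measure R) 2%:E.

Definition L2_norm (R : realType) (g : R -> R) : \bar R :=
  'N[@lebesgue_measure R]_2%:E[EFin \o (g \_ `]0, pi[)].

Definition lincomb (R : realType) (psi : nat -> R -> R) (a : nat -> R)
    (N : nat) (x : R) : R :=
  \sum_(1 <= n < N.+1) a n * psi n x.

Definition complete_system (R : realType) (psi : nat -> R -> R) : Prop :=
  forall g : R -> R, in_L2 g -> forall e : R, 0 < e ->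
  exists (N : nat) (a : nat -> R),
    (L2_norm (fun x => g x - lincomb psi a N x)%R < e%:E)%E.

Definition riesz_basis (R : realType) (psi : nat -> R -> R) : Prop :=
  [/\ forall n, (1 <= n)%N -> in_L2 (psi n),
      complete_system psi &
      exists c C : R, [/\ 0 < c, 0 < C &
        forall (N : nat) (a : nat -> R),
          ((c * \sum_(1 <= n < N.+1) `|a n| ^+ 2)%R%:E
             <= L2_norm (lincomb psi a N) ^+ 2)%E /\
          (L2_norm (lincomb psi a N) ^+ 2
             <= (C * \sum_(1 <= n < N.+1) `|a n| ^+ 2)%R%:E)%E]].

(* Main.v *)
Require Import Defs.
From mathcomp Require Import all_boot all_order all_algebra.
From mathcomp Require Import all_classical all_reals all_analysis.
From mathcomp Require Import measurable_realfun ring lra.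
Import Order.TTheory GRing.Theory Num.Theory.
Import numFieldNormedType.Exports.
Local Open Scope classical_set_scope.
Local Open Scope ring_scope.

Set Implicit Arguments.
Unset Strict Implicit.
Unset Printing Implicit Defensive.

(* The functions sin (n x) form a complete orthogonal system whose terms have
   squared norm pi / 2, so a system f_n is a Riesz basis as soon as
   sum_n |f_n - sin (n x)|^2 < pi / 2 (a Paley-Wiener perturbation argument).
   Write a, b for the square roots of alpha(n), beta(n).  Uniqueness for the
   initial value problem and the normalization give f_n explicitly as a chain of
   n half sine waves of frequencies a and b, and integrating bump by bump gives
     |f_n - sin (n x)|^2 <= pi / 2 * K_n * ((max a b - n) / n)^2,
   where K_n is 8 for even n and, for odd n, the inverse of the coefficient in
   the hypothesis on c_n.  With this bound, the hypotheses make the n-th term of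
   the sum smaller than pi / 2 * n^-(1+eps) / (zeta (1+eps) - 1).
   Completeness of the sines: a bounded multiple of sin x is approximated by
   sin x times a continuous function of y = (1 + cos x) / 2, and sin x times a
   Bernstein polynomial in y is a combination of the functions sin (n x). *)

(** * Bounds for sin, cos and pi *)

(** The estimate must be quadratic in the excess [max a b - n], although the frequencies and the
    nodes of f_n move linearly with it. The linear terms cancel because the numbers p, q of positive
    and negative bumps satisfy p / a + q / b = 1, which is the equation of the curve. On one bump
    the only delicate quantity is the correlation with sin (n x). It depends on the phases of sin (n
    x) at the two end nodes. These phases vary from bump to bump, but suitably oriented they have
    the same sign and their total is fixed by the width of the bump, so a superadditive lower bound
    for sin controls the correlation uniformly. With p narrow and q wide bumps the resulting
    constant is kap (p^2 + q^2) n^2 / q^4. For kap = 1 this is 8 when p = q = n / 2, and 8 n^2 (n^2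
    + 1) / (n - 1)^4 when q = (n - 1) / 2. When q = (n + 1) / 2 small n force a larger kap, and 5 /
    4 turns the factor 8 into 10. *)

(** Integrating an inequality from 0. Starting from cos <= 1, each of the next four bounds is the
    integral of the previous one. *)
Lemma ge0_of_derive_ge0 (R : realType) (f f' : R -> R) :
  (forall x : R, is_derive x 1 f (f' x)) -> (forall x : R, 0 <= x -> 0 <= f' x) ->
  0 <= f 0 -> forall x : R, 0 <= x -> 0 <= f x.
Proof.
move=> df f'0 f0 x x0; apply: (le_trans f0).
apply: (@ger0_derive1_le_cc _ f 0 x); rewrite ?in_itv /= ?lexx ?x0 //.
- move=> z; rewrite in_itv /= => /andP[z0 _].
  rewrite derive1E (@derive_val _ _ _ _ _ _ _ (df z)).
  by apply: f'0; apply: ltW.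
- apply: continuous_subspaceT => z; apply: differentiable_continuous.
  by apply/derivable1_diffP; have [] := df z.
Qed.

Lemma sin_le_id (R : realType) (x : R) : 0 <= x -> sin x <= x.
Proof.
move=> x0; rewrite -subr_ge0.
apply: (@ge0_of_derive_ge0 R (fun t : R => t - sin t) (fun t => 1 - cos t)) => //.
by rewrite sin0 subr0.
Qed.

Lemma cos_ge_quadratic (R : realType) (x : R) : 0 <= x -> 1 - x ^+ 2 / 2 <= cos x.
Proof.
move=> x0; rewrite -subr_ge0.
apply: (@ge0_of_derive_ge0 R (fun t : R => cos t - (1 - t ^+ 2 / 2))
  (fun t => t - sin t)) => //.
- by move=> t; apply: is_derive_eq; rewrite /GRing.scale /=; field.
- by move=> t t0; rewrite subr_ge0 sin_le_id.
- by rewrite cos0; lra.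
Qed.

Lemma sin_ge_cubic (R : realType) (x : R) : 0 <= x -> x - x ^+ 3 / 6 <= sin x.
Proof.
move=> x0; rewrite -subr_ge0.
apply: (@ge0_of_derive_ge0 R (fun t : R => sin t - (t - t ^+ 3 / 6))
  (fun t => cos t - (1 - t ^+ 2 / 2))) => //.
- by move=> t; apply: is_derive_eq; rewrite /GRing.scale /=; field.
- by move=> t t0; rewrite subr_ge0 cos_ge_quadratic.
- by rewrite sin0; lra.
Qed.

Lemma cos_le_quartic (R : realType) (x : R) :
  0 <= x -> cos x <= 1 - x ^+ 2 / 2 + x ^+ 4 / 24.
Proof.
move=> x0; rewrite -subr_ge0.
apply: (@ge0_of_derive_ge0 R (fun t : R => 1 - t ^+ 2 / 2 + t ^+ 4 / 24 - cos t)
  (fun t => sin t - (t - t ^+ 3 / 6))) => //.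
- by move=> t; apply: is_derive_eq; rewrite /GRing.scale /=; field.
- by move=> t t0; rewrite subr_ge0 sin_ge_cubic.
- by rewrite cos0; lra.
Qed.

Lemma pi_gt_5half (R : realType) : 5 / 2 < pi :> R.
Proof.
have pi0 := pi_gt0 R; have pi2 := pihalf_lt2 R.
rewrite ltNge; apply/negP => h.
have := @cos_ge_quadratic R (pi / 2) ltac:(lra).
by rewrite cos_pihalf; nra.
Qed.

Lemma pi_lt_16fifth (R : realType) : pi < 16 / 5 :> R.
Proof.
have pi0 := pi_gt0 R; have pi2 := pihalf_lt2 R; have pi1 := pi_gt_5half R.
rewrite ltNge; apply/negP => h.
(* If 8 / 5 <= pi / 2 then cos (8 / 5) >= 0, but the quartic bound at 8 / 5 is about -0.007. *)
have := @cos_le_quartic R (8 / 5) ltac:(lra).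
have : 0 <= cos (8 / 5 : R) by apply: cos_ge0_pihalf; lra.
by lra.
Qed.

(* The cube is superadditive: [x ^+ 3 + y ^+ 3 <= (x + y) ^+ 3]. *)
Lemma sin_add_ge_cubic (R : realType) (x y : R) : 0 <= x -> 0 <= y ->
  (x + y) - (x + y) ^+ 3 / 6 <= sin x + sin y.
Proof.
move=> x0 y0; have := sin_ge_cubic x0; have := sin_ge_cubic y0.
have : 0 <= x * y * (x + y) by rewrite !mulr_ge0 // addr_ge0.
by lra.
Qed.

(** * The algebraic inequality behind the distance estimate *)

(* Here [al = n / a] and [be = n / b], with [P] and [Q] the proportions of narrow
   (frequency [a >= n]) and wide (frequency [b <= n]) bumps, and [w] stands for
   [pi ^+ 2].  The left-hand side is [t ^+ 2] times an expression which, once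
   multiplied by [al ^+ 2], is at most its value [P + 3 / 2 P Q + w / 3 P Q] at
   [t = 0]. *)
Lemma wide_narrow_bound (R : realType) (P Q al be t kap w : R) :
  0 < P -> 0 < Q -> P + Q = 1 -> P <= 2 * Q -> 0 < al -> 0 <= t ->
  al = 1 - Q * t -> be = 1 + P * t -> 0 <= w -> w <= 256 / 25 ->
  (P + 5 * P * Q) * Q ^+ 2 <= kap * (P ^+ 2 + Q ^+ 2) ->
  P * al ^+ 3 / be ^+ 2 + Q * be + 1
    - 4 * P * al ^+ 2 / (be * (1 + al)) - 4 * Q * be / (1 + be)
    + 2 * w / 3 * (P * Q ^+ 2 * t ^+ 2 * al ^+ 2 / (be * (1 + al))
                     + Q * P ^+ 2 * t ^+ 2 * be / (1 + be))
  <= kap * (P ^+ 2 + Q ^+ 2) / Q ^+ 4 * ((1 - al) / al) ^+ 2.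
Proof.
move=> P0 Q0 PQ P2Q al0 t0 alE beE w0 wl hk.
have al1 : al <= 1 by rewrite alE; nra.
have be1 : 1 <= be by rewrite beE; nra.
have be0 : 0 < be by lra.
have bm1 : 0 <= be - 1 by lra.
have am1 : 0 <= 1 - al by lra.
have al1p : 0 < 1 + al by lra.
have be1p : 0 < 1 + be by lra.
(* At [al = be = 1] these quotients equal 1, 3 / 4, 1 / 2 and 1 / 2; [h1] to [h4] show that these
   values are upper bounds. *)
pose t1 := al ^+ 3 / be ^+ 2.
pose t2 := al ^+ 2 * (al + be + al * be) / (be * (1 + al) * (1 + be)).
pose t3 := al ^+ 4 / (be * (1 + al)).
pose t4 := al ^+ 2 * be / (1 + be).
have -> : P * al ^+ 3 / be ^+ 2 + Q * be + 1
    - 4 * P * al ^+ 2 / (be * (1 + al)) - 4 * Q * be / (1 + be)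
    + 2 * w / 3 * (P * Q ^+ 2 * t ^+ 2 * al ^+ 2 / (be * (1 + al))
                     + Q * P ^+ 2 * t ^+ 2 * be / (1 + be))
  = (t / al) ^+ 2 *
    (P * t1 + 2 * P * Q * t2 + 2 * w / 3 * (P * Q) * (Q * t3 + P * t4)).
  have PE : P = 1 - Q by lra.
  rewrite /t1 /t2 /t3 /t4.
  have : al != 0 by lra.
  have : be != 0 by lra.
  have : 1 + al != 0 by lra.
  have : 1 + be != 0 by lra.
  rewrite beE alE PE => h1 h2 h3 h4; field.
  by rewrite h1 h2 h3 h4.
have -> : kap * (P ^+ 2 + Q ^+ 2) / Q ^+ 4 * ((1 - al) / al) ^+ 2
   = (t / al) ^+ 2 * (kap * (P ^+ 2 + Q ^+ 2) / Q ^+ 2).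
  have : al != 0 by lra.
  rewrite alE => h1; field.
  by rewrite h1 /=; lra.
apply: ler_wpM2l; first exact: sqr_ge0.
have h1 : t1 <= 1.
  rewrite /t1 ler_pdivrMr ?exprn_gt0// mul1r.
  apply: (@le_trans _ _ 1); first by rewrite exprn_ile1 // ltW.
  by rewrite exprn_ege1.
have h2 : t2 <= 3 / 4.
  rewrite /t2 ler_pdivrMr ?mulr_gt0//.
  have : al ^+ 2 <= 1 by rewrite exprn_ile1 // ltW.
  have : 0 <= be + al * (1 + be) by rewrite addr_ge0 ?mulr_ge0 // ltW.
  have : 0 <= (be - 1) * (1 + al) * be by rewrite !mulr_ge0 // ltW.
  have : 0 <= (1 - al) * be * (1 + be) by rewrite !mulr_ge0 // ltW.
  have : 0 <= (be - 1) * (1 + al) by rewrite mulr_ge0 // ltW.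
  nra.
have h3 : t3 <= 1 / 2.
  rewrite /t3 ler_pdivrMr ?mulr_gt0//.
  have : al ^+ 4 <= al by rewrite -[leRHS]expr1 ler_wiXn2l // ltW.
  nra.
have h4 : t4 <= 1 / 2.
  rewrite /t4 ler_pdivrMr //.
  have : 0 <= al * Q * t by rewrite !mulr_ge0 // ltW.
  have : 0 <= al * P * t by rewrite !mulr_ge0 // ltW.
  (* The coefficient of [t] in the product is [P / 2 - Q], which is why [P <= 2 * Q] is assumed. *)
  have h : al * (1 + P * t / 2) <= 1.
    rewrite alE; have : 0 <= Q * t * (P * t) by rewrite !mulr_ge0 // ltW.
    by nra.
  have h' : al * be <= 1 + (be - 1) / 2 by rewrite beE; nra.
  have -> : al ^+ 2 * be = al * (al * be) by ring.
  have : al * (al * be) <= al * (1 + (be - 1) / 2) by apply: ler_wpM2l => //; exact: ltW.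
  rewrite beE in h' *.
  by nra.
have t30 : 0 <= t3 by rewrite /t3 divr_ge0 ?mulr_ge0 ?exprn_ge0 // ltW.
have PQ0 : 0 < P * Q by rewrite mulr_gt0.
(* The factor 5 absorbs 3 / 2 + w / 3, which is below 4.92 for w <= 256 / 25. *)
apply: (@le_trans _ _ (P + 5 * P * Q)); last first.
  by rewrite ler_pdivlMr ?exprn_gt0.
have : Q * t3 + P * t4 <= 1 / 2 by nra.
move: (Q * t3 + P * t4) => z z2.
have : w * (P * Q) * z <= w * (P * Q) * (1 / 2).
  by apply: ler_wpM2l => //; rewrite mulr_ge0 // ltW.
have : w * (P * Q) <= 256 / 25 * (P * Q) by apply: ler_wpM2r => //; exact: ltW.
have : P * Q * t2 <= P * Q * (3 / 4) by apply: ler_wpM2l => //; exact: ltW.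
by nra.
Qed.

(** [wide_narrow_bound] after rescaling by [n]. The left-hand side times pi / 2 bounds the squared
    distance from sin (n x) of p bumps of frequency [a] and height [b / a] together with q bumps of
    frequency [b] and height 1; the final 1 stands for the sine itself. *)
Lemma fucik_distance_bound (R : realType) (p q n a b kap w : R) :
  0 < p -> 0 < q -> n = p + q -> p <= 2 * q -> 0 < b -> b <= n -> n <= a ->
  p / a + q / b = 1 -> 0 <= w -> w <= 256 / 25 ->
  (p * n + 5 * p * q) * q ^+ 2 <= kap * (p ^+ 2 + q ^+ 2) * n ^+ 2 ->
  p * ((b / a) ^+ 2 / a
       - 4 * (b / a) / (a + n) * (1 - w * (a - n) ^+ 2 / (6 * a ^+ 2)))
  + q * (b^-1 - 4 / (b + n) * (1 - w * (b - n) ^+ 2 / (6 * b ^+ 2))) + 1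
  <= kap * (p ^+ 2 + q ^+ 2) * n ^+ 2 / q ^+ 4 * ((a - n) / n) ^+ 2.
Proof.
move=> p0 q0 nE p2q b0 bn na pq w0 wl hk.
have n0 : 0 < n by lra.
have a0 : 0 < a by lra.
have [nN0 aN0 bN0] : [/\ n != 0, a != 0 & b != 0] by split; lra.
have aDn : a + n != 0 by lra.
have bDn : b + n != 0 by lra.
have qN0 : q != 0 by lra.
pose t := n / b - n / a.
have t0 : 0 <= t by rewrite subr_ge0 ler_wpM2l ?lef_pV2 ?posrE //; lra.
have alE : n / a = 1 - q / n * t.
  transitivity (p / a + q / b - q / n * t); last by rewrite pq.
  by rewrite /t nE; field; rewrite bN0 aN0 -nE nN0.
have beE : n / b = 1 + p / n * t.
  transitivity (p / a + q / b + p / n * t); last by rewrite pq.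
  by rewrite /t nE; field; rewrite bN0 aN0 -nE nN0.
have hk' : (p / n + 5 * (p / n) * (q / n)) * (q / n) ^+ 2
    <= kap * ((p / n) ^+ 2 + (q / n) ^+ 2).
  have -> : (p / n + 5 * (p / n) * (q / n)) * (q / n) ^+ 2
    = (p * n + 5 * p * q) * q ^+ 2 / n ^+ 4 by field.
  have -> : kap * ((p / n) ^+ 2 + (q / n) ^+ 2)
    = kap * (p ^+ 2 + q ^+ 2) * n ^+ 2 / n ^+ 4 by field.
  by rewrite ler_pM2r // invr_gt0 exprn_gt0.
have := @wide_narrow_bound R (p / n) (q / n) (n / a) (n / b) t kap w
  ltac:(by rewrite divr_gt0) ltac:(by rewrite divr_gt0)
  ltac:(by rewrite -mulrDl -nE divff)
  ltac:(by rewrite mulrA ler_pM2r // invr_gt0)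
  ltac:(by rewrite divr_gt0) t0 alE beE w0 wl hk'.
congr (_ <= _); last by field; rewrite nN0 qN0 aN0.
have qt : q / n * t = (a - n) / a.
  have -> : (a - n) / a = 1 - n / a by field.
  by rewrite alE; ring.
have pt : p / n * t = (n - b) / b.
  have -> : (n - b) / b = n / b - 1 by field.
  by rewrite beE; ring.
have -> : p / n * (q / n) ^+ 2 * t ^+ 2 = p / n * ((a - n) / a) ^+ 2.
  by rewrite -qt; ring.
have -> : q / n * (p / n) ^+ 2 * t ^+ 2 = q / n * ((n - b) / b) ^+ 2.
  by rewrite -pt; ring.
by field; rewrite bDn nN0 aDn bN0 aN0.
Qed.

(** * Integral over one bump *)

Lemma integral_of_derivative (R : realType) (F f : R -> R) (s e : R) :
  s < e -> (forall x : R, is_derive x 1 F (f x)) -> continuous f ->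
  (\int[@lebesgue_measure R]_(x in `[s, e]) (f x)%:E = (F e - F s)%:E)%E.
Proof.
move=> se dF cf; rewrite EFinB; apply: continuous_FTC2 => //.
- exact: continuous_subspaceT.
- have cF : continuous F.
    move=> x; apply: differentiable_continuous.
    by apply/derivable1_diffP; have [] := dF x.
  split; first by move=> x _; have [] := dF x.
  + by apply: cvg_at_right_filter; exact: cF.
  + by apply: cvg_at_left_filter; exact: cF.
- by move=> x _; rewrite derive1E (@derive_val _ _ _ _ _ _ _ (dF x)).
Qed.

Lemma cos_double (R : realType) (x : R) : cos (2 * x) = 1 - 2 * sin x ^+ 2.
Proof.
have -> : 2 * x = x *+ 2 by rewrite mulr2n; ring.
by rewrite cos_mulr2n cos2sin2 mulr2n; ring.
Qed.

Lemma sin_at_bump_end (R : realType) (w s : R) : w != 0 ->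
  sin (w * (s + pi / w - s)) = 0 :> R /\ cos (w * (s + pi / w - s)) = -1 :> R
  /\ sin (2 * w * (s + pi / w - s)) = 0 :> R.
Proof.
move=> w0.
have -> : w * (s + pi / w - s) = pi by field.
have -> : 2 * w * (s + pi / w - s) = pi *+ 2 by rewrite mulr2n; field.
by rewrite sinpi cospi sin2pi.
Qed.

(** The values of sin (2 n x) / (4 n) at the two ends are kept apart because they telescope over
    consecutive bumps and vanish at 0 and pi. *)
Lemma bump_integral (R : realType) (C w n s : R) : 0 < w -> 0 < n -> w != n ->
  (\int[@lebesgue_measure R]_(x in `[s, (s + pi / w)%R])
     ((C * sin (w * (x - s)) - sin (n * x)) ^+ 2)%:E
   = (C ^+ 2 * (pi / (2 * w)) + pi / (2 * w)
      - (sin (2 * n * (s + pi / w)) / (4 * n) - sin (2 * n * s) / (4 * n))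
      - 2 * C * (w * (sin (n * s) + sin (n * (s + pi / w)))
                  / (w ^+ 2 - n ^+ 2)))%:E)%E.
Proof.
move=> w0 n0 wn.
have wN0 : w != 0 by rewrite gt_eqF.
have nN0 : n != 0 by rewrite gt_eqF.
have wnN0 : w ^+ 2 - n ^+ 2 != 0.
  by rewrite subr_sqr mulf_neq0 ?subr_eq0 // gt_eqF // addr_gt0.
pose F (x : R) : R := C ^+ 2 * (x / 2 - sin (2 * w * (x - s)) / (4 * w))
  + x / 2 - sin (2 * n * x) / (4 * n)
  - 2 * C * ((n * sin (w * (x - s)) * cos (n * x)
              - w * cos (w * (x - s)) * sin (n * x)) / (w ^+ 2 - n ^+ 2)).
have lt : s < s + pi / w by rewrite ltrDl divr_gt0 ?pi_gt0.
have dF (x : R) : is_derive x 1 F ((C * sin (w * (x - s)) - sin (n * x)) ^+ 2).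
  apply: is_derive_eq; rewrite /GRing.scale /=.
  have -> : 2 * w * (x - s) = 2 * (w * (x - s)) by ring.
  have -> : 2 * n * x = 2 * (n * x) by ring.
  rewrite (cos_double (w * _)) (cos_double (n * _)).
  move: (sin _) (sin _) (cos _) (cos _) => *.
  by field; rewrite nN0 wN0 wnN0.
have cf : continuous (fun x : R => (C * sin (w * (x - s)) - sin (n * x)) ^+ 2).
  have H : forall x : R, derivable
     (fun x : R => (C * sin (w * (x - s)) - sin (n * x)) ^+ 2) x 1.
    by move=> x; apply: ex_derive.
  move=> x; apply: differentiable_continuous.
  by apply/derivable1_diffP.
rewrite (integral_of_derivative lt dF cf); congr (_%:E); rewrite /F.
have [-> [-> ->]] := sin_at_bump_end s wN0.
rewrite !subrr !mulr0 !sin0 !cos0.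
move: (sin _) (sin _) (sin _) (sin _) (cos _) (cos _) => *.
by field; rewrite nN0 wN0 wnN0.
Qed.

(** Here [x] and [y] are the phase errors of sin (n x) at the two ends of a bump, oriented so that
    both have the sign of [w - n]. Only their sum is known, and the superadditive cubic bound needs
    no more than that. *)
Lemma bump_correlation (R : realType) (w n x y : R) : 0 < w -> 0 < n -> w != n ->
  0 <= x * (w - n) -> 0 <= y * (w - n) -> x + y = pi * (w - n) / w ->
  pi / (w + n) * (1 - pi ^+ 2 * (w - n) ^+ 2 / (6 * w ^+ 2))
  <= w * (sin x + sin y) / (w ^+ 2 - n ^+ 2).
Proof.
move=> w0 n0 wn hx hy hxy.
have wN0 : w != 0 by rewrite gt_eqF.
have wDn : 0 < w + n by rewrite addr_gt0.
have wDn0 : w + n != 0 by rewrite gt_eqF.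
have wBn0 : w - n != 0 by rewrite subr_eq0.
have -> : pi / (w + n) * (1 - pi ^+ 2 * (w - n) ^+ 2 / (6 * w ^+ 2))
  = w * ((x + y) - (x + y) ^+ 3 / 6) / (w ^+ 2 - n ^+ 2).
  by rewrite hxy subr_sqr; field; rewrite wDn0 wBn0 wN0.
have key z : w * z / (w ^+ 2 - n ^+ 2) = z / (w - n) * (w / (w + n)).
  by rewrite subr_sqr; field; rewrite wDn0 wBn0.
rewrite !key ler_pM2r ?divr_gt0 //.
move: wn; rewrite neq_lt => /orP[|] wn.
  have wn0 : w - n < 0 by rewrite subr_lt0.
  have x0 : 0 <= - x by rewrite oppr_ge0 -(nmulr_lge0 _ wn0).
  have y0 : 0 <= - y by rewrite oppr_ge0 -(nmulr_lge0 _ wn0).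
  rewrite ler_ndivlMr // divfK //.
  have := sin_add_ge_cubic x0 y0; rewrite !sinN.
  by move: (sin x) (sin y) => *; nra.
have wn0 : 0 < w - n by rewrite subr_gt0.
rewrite ler_pM2r ?invr_gt0 //.
by apply: sin_add_ge_cubic; rewrite -(pmulr_lge0 _ wn0).
Qed.

(** * Explicit form of the eigenfunctions *)

Lemma has_derivative_in_is_derive (R : realType) (A : set R) (f : R -> R) (x l : R) :
  nbhs x A -> has_derivative_in A f x l -> is_derive x 1 f l.
Proof.
move=> Ax dfx; apply/is_derive1_caratheodory.
exists (fun z => if z == x then l else (f z - f x) / (z - x)); split.
- move=> z; case: eqVneq => [->|zx]; first by rewrite !subrr mulr0.
  by rewrite divfK // subr_eq0.
- rewrite /prop_for /continuous_at /= eqxx; apply/cvgrPdist_lt => e e0.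
  move/cvgrPdist_lt : dfx => /(_ _ e0); rewrite !near_withinE => h.
  near=> z; case: eqVneq => [_|zx]; first by rewrite subrr normr0.
  move: zx; near: z; apply: filterS2 Ax h => z Az + zx; exact.
- by rewrite eqxx.
Unshelve. all: by end_near.
Qed.

Lemma has_derivative_in_continuous (R : realType) (A : set R) (f f' : R -> R) :
  (forall x, A x -> has_derivative_in A f x (f' x)) -> {within A, continuous f}.
Proof.
move=> df; apply/subspace_continuousP => x Ax.
have := df x Ax => /cvgrPdist_lt /(_ _ ltr01); rewrite !near_withinE => h.
apply/cvgrPdist_lt => e e0; rewrite near_withinE.
have k0 : 0 < `|f' x| + 1 by rewrite ltr_wpDl.
near=> y => Ay.
have [->|yx] := eqVneq y x; first by rewrite subrr normr0.
have yx0 : y - x != 0 by rewrite subr_eq0.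
have q : `|f' x - (f y - f x) / (y - x)| < 1.
  by apply: (near h y).
have yxe : `|x - y| < e / (`|f' x| + 1).
  near: y; apply: cvgr_dist_lt; last by rewrite divr_gt0.
  exact: cvg_id.
rewrite distrC -(divfK yx0 (f y - f x)) normrM [`|y - x|]distrC.
apply: (@le_lt_trans _ _ ((`|f' x| + 1) * `|x - y|)).
  apply: ler_wpM2r => //.
  set Q := _ / _ in q *.
  have -> : Q = f' x - (f' x - Q) by ring.
  by apply: (le_trans (ler_normB _ _)); rewrite lerD2l ltW.
by rewrite mulrC -ltr_pdivlMr.
Unshelve. all: by end_near.
Qed.

(** The product of [E] with exp (- L x) is nonincreasing and starts at 0. *)
Lemma gronwall_zero (R : realType) (E E' : R -> R) (s e L : R) :
  {within `[s, e], continuous E} ->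
  (forall x, x \in `]s, e[ -> is_derive x 1 E (E' x)) ->
  (forall x, x \in `]s, e[ -> E' x <= L * E x) ->
  (forall x, 0 <= E x) -> E s = 0 -> forall x, x \in `[s, e] -> E x = 0.
Proof.
move=> cE dE E'L E0 Es x xse.
have [sx xe] : s <= x /\ x <= e by move: xse; rewrite in_itv => /andP.
pose h (y : R) := E y * expR (- L * y).
have dh (y : R) : y \in `]s, e[ ->
    is_derive y 1 h ((E' y - L * E y) * expR (- L * y)).
  move=> yse; have := dE y yse => dEy.
  by apply: is_derive_eq; rewrite /GRing.scale /=; ring.
have ch : {within `[s, e], continuous h}.
  apply/subspace_continuousP => y yse; apply: cvgM.
    by move/subspace_continuousP : cE; exact.
  apply: cvg_within_filter.
  have H : derivable (fun y : R => expR (- L * y)) y 1 by apply: ex_derive.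
  apply: (differentiable_continuous (f := fun y : R => expR (- L * y))).
  exact/derivable1_diffP.
apply/eqP; rewrite eq_le E0 andbT.
have : h x <= h s.
  apply: (@ler0_derive1_le_cc _ h s e _ _ ch).
  - by move=> y yse; have [] := dh y yse.
  - move=> y yse; rewrite derive1E (@derive_val _ _ _ _ _ _ _ (dh y yse)).
    by rewrite mulr_le0_ge0 ?expR_ge0 // subr_le0 E'L.
  - exact: xse.
  - by rewrite in_itv /= lexx (le_trans sx xe).
  - exact: sx.
by rewrite /h Es mul0r pmulr_lle0 // expR_gt0.
Qed.

(** Gronwall for the energy (f - g)^2 + (f1 - g1)^2, whose derivative is at most 1 + L times itself
    by 2 u v <= u^2 + v^2. Derivatives are required only in the open interval, where the
    differential equation is given. *)
Lemma second_order_unique (R : realType) (f f1 f2 g g1 g2 : R -> R) (s e L : R) :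
  {within `[s, e], continuous f} -> {within `[s, e], continuous f1} ->
  {within `[s, e], continuous g} -> {within `[s, e], continuous g1} ->
  (forall x, x \in `]s, e[ -> is_derive x 1 f (f1 x)) ->
  (forall x, x \in `]s, e[ -> is_derive x 1 f1 (f2 x)) ->
  (forall x, x \in `]s, e[ -> is_derive x 1 g (g1 x)) ->
  (forall x, x \in `]s, e[ -> is_derive x 1 g1 (g2 x)) ->
  0 <= L ->
  (forall x, x \in `]s, e[ -> `|f2 x - g2 x| <= L * `|f x - g x|) ->
  f s = g s -> f1 s = g1 s ->
  forall x, x \in `[s, e] -> f x = g x /\ f1 x = g1 x.
Proof.
move=> cf cf1 cg cg1 df df1 dg dg1 L0 lip fs f1s x xse.
pose E y := (f y - g y) ^+ 2 + (f1 y - g1 y) ^+ 2.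
have E0 : E x = 0.
  apply: (@gronwall_zero _ E (fun y => 2 * (f y - g y) * (f1 y - g1 y)
    + 2 * (f1 y - g1 y) * (f2 y - g2 y)) s e (1 + L)) => //.
  - apply/subspace_continuousP => y yse; rewrite /E.
    move/subspace_continuousP : cf => /(_ _ yse) cf.
    move/subspace_continuousP : cf1 => /(_ _ yse) cf1.
    move/subspace_continuousP : cg => /(_ _ yse) cg.
    move/subspace_continuousP : cg1 => /(_ _ yse) cg1.
    by apply: cvgD; apply: cvgM; apply: cvgB.
  - move=> y yse; have := df y yse => h1; have := df1 y yse => h2.
    have := dg y yse => h3; have := dg1 y yse => h4.
    by apply: is_derive_eq; rewrite /GRing.scale /=; ring.
  - move=> y yse; have := lip y yse; rewrite /E.
    set u := f y - g y; set v := f1 y - g1 y; set z := f2 y - g2 y => uz.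
    have h1 : 2 * u * v <= u ^+ 2 + v ^+ 2 by have := sqr_ge0 (u - v); nra.
    have h2 : v * z <= `|v| * (L * `|u|).
      by rewrite (le_trans (ler_norm _)) // normrM ler_wpM2l.
    have h3 : 2 * (`|v| * `|u|) <= u ^+ 2 + v ^+ 2.
      rewrite -(real_normK (num_real u)) -(real_normK (num_real v)).
      by have := sqr_ge0 (`|u| - `|v|); nra.
    have : L * (2 * (`|v| * `|u|)) <= L * (u ^+ 2 + v ^+ 2) by apply: ler_wpM2l.
    by nra.
  - by move=> y; rewrite /E addr_ge0 // sqr_ge0.
  - by rewrite /E fs f1s !subrr expr0n addr0.
move/eqP : E0; rewrite paddr_eq0 ?sqr_ge0 // !sqrf_eq0 !subr_eq0.
by move=> /andP[/eqP -> /eqP ->].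
Qed.

Lemma max_lipschitz (R : realType) (al be u v : R) : 0 < al -> 0 < be ->
  `|- (al * Num.max u 0 - be * Num.max (- u) 0)
    + (al * Num.max v 0 - be * Num.max (- v) 0)| <= (al + be) * `|u - v|.
Proof.
move=> al0 be0.
have lip (x y : R) : `|Num.max x 0 - Num.max y 0| <= `|x - y|.
  rewrite /Num.max; case: ltrP => x0; case: ltrP => y0; rewrite ler_norml;
  by case: (ger0P (x - y)) => xy; apply/andP; split; lra.
have -> : - (al * Num.max u 0 - be * Num.max (- u) 0)
    + (al * Num.max v 0 - be * Num.max (- v) 0)
  = al * (Num.max v 0 - Num.max u 0) + be * (Num.max (- u) 0 - Num.max (- v) 0).
  by ring.
apply: (le_trans (ler_normD _ _)); rewrite !normrM (gtr0_norm al0) (gtr0_norm be0).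
rewrite mulrDl lerD // ler_wpM2l ?(ltW al0) ?(ltW be0) //.
  by rewrite [leRHS]distrC.
apply: (le_trans (lip _ _)).
by rewrite -opprD normrN.
Qed.

(** A half wave [k * y] has the constant sign of [k], so only one of the two terms of the
    nonlinearity acts and the equation is linear with the matching frequency. *)
Lemma fucik_restoring_bump (R : realType) (al be w k y : R) :
  0 < al -> 0 < be -> 0 <= y ->
  (w ^+ 2 = al /\ 0 <= k) \/ (w ^+ 2 = be /\ k <= 0) ->
  - (- w ^+ 2 * (k * y)) = al * Num.max (k * y) 0 - be * Num.max (- (k * y)) 0.
Proof.
move=> al0 be0 y0 [[-> k0]|[-> k0]].
- have ky : 0 <= k * y by rewrite mulr_ge0.
  by rewrite (max_idPl ky) (max_idPr _) ?oppr_le0 //; ring.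
- have ky : k * y <= 0 by rewrite mulr_le0_ge0.
  by rewrite (max_idPr ky) (max_idPl _) ?oppr_ge0 //; ring.
Qed.

(** The solution and the half sine wave have the same initial data at [s], so they agree until the
    wave returns to 0. The final value and slope are the initial data of the next bump. *)
Lemma fucik_solution_bump (R : realType) (al be : R) (f f1 f2 : R -> R)
    (w k s : R) :
  C2_in `[0, pi] f f1 f2 -> fucik_bvp al be f f2 ->
  0 < al -> 0 < be -> 0 < w ->
  (w ^+ 2 = al /\ 0 <= k) \/ (w ^+ 2 = be /\ k <= 0) ->
  0 <= s -> s + pi / w <= pi -> f s = 0 -> f1 s = k * w ->
  (forall x, x \in `[s, s + pi / w] -> f x = k * sin (w * (x - s))) /\
  f (s + pi / w) = 0 /\ f1 (s + pi / w) = - k * w.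
Proof.
move=> [df df1 _] [ode _ _] al0 be0 w0 wk s0 se fs f1s.
have wN0 : w != 0 by rewrite gt_eqF.
have sse : s < s + pi / w by rewrite ltrDl divr_gt0 ?pi_gt0.
have sub : `[s, s + pi / w] `<=` `[0, pi].
  move=> x /=; rewrite !in_itv /= => /andP[h1 h2].
  by rewrite (le_trans s0 h1) (le_trans h2 se).
have subo x : x \in `]s, s + pi / w[ -> x \in `]0, pi[.
  rewrite !in_itv /= => /andP[h1 h2].
  by rewrite (le_lt_trans s0 h1) (lt_le_trans h2 se).
have inb x : x \in `]0, pi[ -> nbhs x (`[0, pi]%classic : set R).
  move=> xI; apply: (@filterS _ _ _ `]0, pi[%classic).
    by apply: subset_itv_oo_cc.
  by apply: open_nbhs_nbhs; split => //; exact: interval_open.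
have inA x : x \in `]0, pi[ -> `[0, pi]%classic x.
  by apply: subset_itv_oo_cc.
pose g x := k * sin (w * (x - s)).
pose g1 x := k * w * cos (w * (x - s)).
pose g2 x := - w ^+ 2 * (k * sin (w * (x - s))).
have dg (x : R) : is_derive x 1 g (g1 x).
  by rewrite /g1; apply: is_derive_eq; rewrite /GRing.scale /=; ring.
have dg1 (x : R) : is_derive x 1 g1 (g2 x).
  by rewrite /g2; apply: is_derive_eq; rewrite /GRing.scale /=; ring.
have cg : continuous g.
  move=> x; apply: differentiable_continuous.
  by apply/derivable1_diffP; have [] := dg x.
have cg1 : continuous g1.
  move=> x; apply: differentiable_continuous.
  by apply/derivable1_diffP; have [] := dg1 x.
have main : forall x, x \in `[s, s + pi / w] -> f x = g x /\ f1 x = g1 x.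
  apply: (@second_order_unique _ f f1 f2 g g1 g2 s (s + pi / w) (al + be)).
  - exact/(continuous_subspaceW sub)/has_derivative_in_continuous/df.
  - exact/(continuous_subspaceW sub)/has_derivative_in_continuous/df1.
  - exact: continuous_subspaceT.
  - exact: continuous_subspaceT.
  - move=> x /subo xI; apply: has_derivative_in_is_derive (inb _ xI) _.
    exact/df/inA.
  - move=> x /subo xI; apply: has_derivative_in_is_derive (inb _ xI) _.
    exact/df1/inA.
  - by rewrite addr_ge0 // ltW.
  - move=> x xse; have := ode x (subo x xse) => fx.
    have sn : 0 <= sin (w * (x - s)).
      apply: sin_ge0_pi; move: xse; rewrite in_itv /= => /andP[h1 h2].
      rewrite mulr_ge0 ?subr_ge0 ?ltW //=.
      have -> : pi = w * (s + pi / w - s) :> R by field.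
      by rewrite ltr_pM2l // ltrD2r.
    have gx := fucik_restoring_bump al0 be0 sn wk.
    have -> : f2 x - g2 x =
       - (al * Num.max (f x) 0 - be * Num.max (- f x) 0)
       + (al * Num.max (g x) 0 - be * Num.max (- g x) 0).
      by rewrite -fx opprK /g -gx /g2.
    exact: max_lipschitz.
  - by rewrite fs /g subrr mulr0 sin0 mulr0.
  - by rewrite f1s /g1 subrr mulr0 cos0 mulr1.
have eI : s + pi / w \in `[s, s + pi / w] by rewrite in_itv /= lexx ltW.
have [fe f1e] := main _ eI.
split; first by move=> x xI; have [] := main _ xI.
have [se0 [ce0 _]] := sin_at_bump_end s wN0.
by rewrite fe f1e /g /g1 se0 ce0 mulr0; split => //; ring.
Qed.

(* For [a = Num.sqrt alpha] and [b = Num.sqrt beta], a Fucik eigenfunction is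
   positive between the nodes j and j + 1 for even j, negative for odd j. *)
Definition bump_freq (R : realType) (a b : R) (j : nat) : R :=
  if odd j then b else a.

(** Bumps alternate starting with a positive one, so [uphalf j] of the first j have width pi / a. *)
Definition node (R : realType) (a b : R) (j : nat) : R :=
  (uphalf j)%:R * (pi / a) + (j./2)%:R * (pi / b).

Lemma node0 (R : realType) (a b : R) : node a b 0 = 0.
Proof. by rewrite /node /= !mul0r addr0. Qed.

Lemma nodeS (R : realType) (a b : R) (j : nat) :
  node a b j.+1 = node a b j + pi / bump_freq a b j.
Proof.
rewrite /node /bump_freq /= uphalf_half; case: (odd j) => /=.
  by rewrite add1n -natr1; ring.
by rewrite add0n -natr1; ring.
Qed.

Lemma bump_freq_gt0 (R : realType) (a b : R) (j : nat) :
  0 < a -> 0 < b -> 0 < bump_freq a b j.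
Proof. by rewrite /bump_freq; case: odd. Qed.

Lemma node_le (R : realType) (a b : R) (i j : nat) :
  0 < a -> 0 < b -> (i <= j)%N -> node a b i <= node a b j.
Proof.
move=> a0 b0; elim: j => [|j IH]; first by rewrite leqn0 => /eqP ->.
rewrite leq_eqVlt => /orP[/eqP -> //|]; rewrite ltnS => /IH h.
by rewrite nodeS (le_trans h) // lerDl divr_ge0 ?pi_ge0 // ltW // bump_freq_gt0.
Qed.

Lemma node_ge0 (R : realType) (a b : R) (j : nat) :
  0 < a -> 0 < b -> 0 <= node a b j.
Proof. by move=> a0 b0; rewrite -(node0 a b) node_le. Qed.

Lemma node_interval (R : realType) (a b x : R) (n : nat) : (0 < n)%N ->
  0 <= x -> x <= node a b n ->
  exists2 j, (j < n)%N & x \in `[node a b j, node a b j.+1].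
Proof.
elim: n => // n IH _ x0 xn.
have [xl|xl] := leP (node a b n) x; first by exists n => //; rewrite in_itv /= xl.
have [n0|n0] := posnP n.
  by move: xl; rewrite n0 node0 ltNge x0.
by have [j jn xj] := IH n0 x0 (ltW xl); exists j => //; exact: leqW.
Qed.

(** Both parities of [fucik_curve] become one equation, which says that the n-th node is pi. *)
Lemma sqrt_curve_ratio (R : realType) (n : nat) (al be : R) : (2 <= n)%N ->
  fucik_curve n (al, be) ->
  (uphalf n)%:R / Num.sqrt al + (n./2)%:R / Num.sqrt be = 1.
Proof.
move=> n2 [/= al0 be0 h].
have nE : n%:R = (odd n)%:R + 2 * (n./2)%:R :> R.
  by rewrite -{1}(odd_double_half n) natrD -muln2 natrM mulrC.
have uE : (uphalf n)%:R = (odd n)%:R + (n./2)%:R :> R.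
  by rewrite uphalf_half natrD.
have pE : n.-1%:R = n%:R - 1 :> R by rewrite -[in RHS](prednK (ltnW n2)) -natr1 addrK.
have : pi * ((uphalf n)%:R / Num.sqrt al + (n./2)%:R / Num.sqrt be) = pi :> R.
  move: h; case: ifP => on h; rewrite -[RHS]h ?pE -?natr1 nE uE on /=.
    by field; rewrite !gt_eqF ?sqrtr_gt0.
  by field; rewrite !gt_eqF ?sqrtr_gt0.
have pN0 : pi != 0 :> R by rewrite gt_eqF ?pi_gt0.
by move=> E; apply: (mulfI pN0); rewrite E mulr1.
Qed.

(** Each bump ends with the opposite of its initial slope, so the slope keeps its modulus [f1 0] at
    every node, and a bump of frequency w has height [f1 0] / w. *)
Lemma fucik_solution_nodes (R : realType) (n : nat) (al be : R)
    (f f1 f2 : R -> R) :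
  let a := Num.sqrt al in let b := Num.sqrt be in
  0 < al -> 0 < be -> C2_in `[0, pi] f f1 f2 -> fucik_bvp al be f f2 ->
  0 < f1 0 -> node a b n = pi ->
  forall j, (j <= n)%N -> [/\ f (node a b j) = 0,
    f1 (node a b j) = (-1) ^+ j * f1 0 &
    (j < n)%N -> forall x, x \in `[node a b j, node a b j.+1] ->
      f x = (-1) ^+ j * (f1 0 / bump_freq a b j)
            * sin (bump_freq a b j * (x - node a b j))].
Proof.
move=> a b al0 be0 c2 bvp f10 npi.
have a0 : 0 < a by rewrite sqrtr_gt0.
have b0 : 0 < b by rewrite sqrtr_gt0.
have step j : (j < n)%N -> f (node a b j) = 0 ->
    f1 (node a b j) = (-1) ^+ j * f1 0 ->
  (forall x, x \in `[node a b j, node a b j.+1] ->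
      f x = (-1) ^+ j * (f1 0 / bump_freq a b j)
            * sin (bump_freq a b j * (x - node a b j))) /\
  f (node a b j.+1) = 0 /\ f1 (node a b j.+1) = (-1) ^+ j.+1 * f1 0.
  move=> jn fj f1j; have w0 := bump_freq_gt0 j a0 b0.
  have wN0 : bump_freq a b j != 0 by rewrite gt_eqF.
  have -> : (-1) ^+ j.+1 * f1 0
    = - ((-1) ^+ j * (f1 0 / bump_freq a b j)) * bump_freq a b j.
    by rewrite exprS; field.
  rewrite nodeS; apply: (fucik_solution_bump c2 bvp al0 be0 w0) => //.
  - rewrite /bump_freq -signr_odd; case: (odd j) => /=.
      right; rewrite (sqr_sqrtr (ltW be0)); split => //.
      by rewrite expr1 mulN1r oppr_le0 divr_ge0 ?(ltW f10) ?(ltW b0).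
    left; rewrite (sqr_sqrtr (ltW al0)); split => //.
    by rewrite expr0 mul1r divr_ge0 ?(ltW f10) ?(ltW a0).
  - exact: node_ge0.
  - by rewrite -nodeS -npi node_le.
  - by rewrite f1j; field.
have ends j : (j <= n)%N ->
    f (node a b j) = 0 /\ f1 (node a b j) = (-1) ^+ j * f1 0.
  elim: j => [_|j IH jn].
    by rewrite node0 expr0 mul1r; case: bvp.
  have [fj f1j] := IH (ltnW jn).
  by have [_ [? ?]] := step j jn fj f1j.
move=> j jn; have [fj f1j] := ends j jn; split => // jn'.
by have [] := step j jn' fj f1j.
Qed.

(** Only the initial slope is left to determine. The tallest bumps have the lowest frequency, so the
    supremum is [f1 0 / Num.min a b], and the normalization gives [f1 0 = Num.min a b]. *)
Lemma normalized_fucik_explicit (R : realType) (n : nat) (al be : R) (f : R -> R) :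
  let a := Num.sqrt al in let b := Num.sqrt be in
  (2 <= n)%N -> fucik_curve n (al, be) ->
  normalized_fucik_eigenfunction n al be f ->
  {within `[0, pi], continuous f} /\
  forall j, (j < n)%N -> forall x, x \in `[node a b j, node a b j.+1] ->
    f x = (-1) ^+ j * (Num.min a b / bump_freq a b j)
          * sin (bump_freq a b j * (x - node a b j)).
Proof.
move=> a b n2 curve; have [/= al0 be0 _] := curve.
rewrite /normalized_fucik_eigenfunction; case: eqP => [n1|_]; first by rewrite n1 in n2.
move=> [f1 [f2 [c2 bvp f10 sup1]]].
split; first by case: c2 => df _ _; exact: has_derivative_in_continuous df.
have a0 : 0 < a by rewrite sqrtr_gt0.
have b0 : 0 < b by rewrite sqrtr_gt0.
have m0 : 0 < Num.min a b by rewrite lt_min a0.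
have npi : node a b n = pi.
  have h := sqrt_curve_ratio n2 curve.
  rewrite /node.
  have -> : (uphalf n)%:R * (pi / a) + n./2%:R * (pi / b)
    = pi * ((uphalf n)%:R / a + n./2%:R / b) :> R by ring.
  by rewrite h mulr1.
have sol := fucik_solution_nodes al0 be0 c2 bvp f10 npi.
suff A1 : f1 0 = Num.min a b.
  move=> j jn x xj; have [_ _ /(_ jn x xj)] := sol j (ltnW jn).
  by rewrite A1.
have wm j : Num.min a b <= bump_freq a b j.
  by rewrite /bump_freq ge_min; case: odd; rewrite lexx ?orbT.
have ub x : x \in `[0, pi] -> `|f x| <= f1 0 / Num.min a b.
  rewrite in_itv /= => /andP[x0 xpi].
  have [j jn xj] := @node_interval R a b x n (ltnW n2) x0 ltac:(by rewrite npi).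
  have [_ _ /(_ jn x xj) ->] := sol j (ltnW jn).
  rewrite normrM normrMsign -[leRHS]mulr1.
  have w0 := bump_freq_gt0 j a0 b0.
  rewrite ger0_norm ?divr_ge0 ?(ltW f10) ?(ltW w0) //.
  apply: ler_pM => //; first by rewrite divr_ge0 ?(ltW f10) ?(ltW w0).
  - by rewrite ler_pM2l // lef_pV2 ?posrE.
  - exact: sin_max.
(* Since n >= 2, bumps 0 and 1 are both present, one of each frequency; the height is reached at the
   midpoint. *)
have att j : (j < 2)%N -> exists2 x, x \in `[0, pi] & `|f x| = f1 0 / bump_freq a b j.
  move=> j2; have jn : (j < n)%N by rewrite (leq_trans j2).
  have w0 := bump_freq_gt0 j a0 b0; have p0 := pi_gt0 R.
  have pw0 : 0 < pi / bump_freq a b j by rewrite divr_gt0.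
  have xj : node a b j + pi / bump_freq a b j / 2 \in `[node a b j, node a b j.+1].
    by rewrite in_itv /= nodeS; apply/andP; split; lra.
  exists (node a b j + pi / bump_freq a b j / 2).
    move: xj; rewrite !in_itv /= => /andP[h1 h2].
    rewrite (le_trans (node_ge0 j a0 b0) h1) /= (le_trans h2) //.
    by rewrite -npi node_le.
  have [_ _ /(_ jn _ xj) ->] := sol j (ltnW jn).
  have -> : bump_freq a b j * (node a b j + pi / bump_freq a b j / 2 - node a b j)
    = pi / 2 by field; rewrite gt_eqF.
  by rewrite sin_pihalf mulr1 normrMsign ger0_norm // divr_ge0 ?(ltW f10) ?(ltW w0).
have supE : sup [set `|f x| | x in `[0, pi]] = f1 0 / Num.min a b.
  apply/eqP; rewrite eq_le; apply/andP; split.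
    apply: ge_sup; first by exists `|f 0|, 0 => //=; rewrite in_itv /= lexx pi_ge0.
    by move=> _ [x xI <-]; exact: ub.
  have [x xI <-] : exists2 x, x \in `[0, pi] & `|f x| = f1 0 / Num.min a b.
    rewrite /Num.min; case: ifP => _; first exact: (att 0%N).
    exact: (att 1%N).
  apply: ub_le_sup; last by exists x.
  by exists (f1 0 / Num.min a b) => _ [y yI <-]; exact: ub.
move: sup1; rewrite supE => /(congr1 (fun z => z * Num.min a b)).
by rewrite mul1r divfK // gt_eqF.
Qed.

(** * Distance to the sine functions *)

(** The total interval is open on the left so that the induction splits it into disjoint half-open
    pieces, each contained in the closed piece that is estimated. *)
Lemma integral_partition_le (R : realType) (h : R -> R) (x V : nat -> R) (n : nat) :
  (forall j, (j < n)%N -> x j <= x j.+1) -> (forall y, 0 <= h y) ->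
  measurable_fun `[x 0%N, x n] h ->
  (forall j, (j < n)%N ->
    (\int[@lebesgue_measure R]_(y in `[x j, x j.+1]) (h y)%:E <= (V j)%:E)%E) ->
  (\int[@lebesgue_measure R]_(y in `]x 0%N, x n]) (h y)%:E
    <= (\sum_(j < n) V j)%:E)%E.
Proof.
move=> xle h0; elim: n => [|n IH] in xle *.
  move=> _ _; rewrite big_ord0 set_itv_ge ?integral_set0 //.
  by rewrite bnd_simp ltxx.
move=> mh hV.
have x0n m : (m <= n.+1)%N -> x 0%N <= x m.
  elim: m => // m IHm mn; exact: le_trans (IHm (ltnW mn)) (xle _ mn).
have mh' (A : set R) : measurable A -> A `<=` `[x 0%N, x n.+1] ->
    measurable_fun A h.
  by move=> mA AB; apply: measurable_funS mh.
rewrite (@itv_bndbnd_setU _ _ _ (BRight (x n))) ?bnd_simp ?x0n ?xle //.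
rewrite ge0_integral_setU //=; last 3 first.
- apply/measurable_EFinP; apply: mh'; first exact: measurableU.
  move=> y []/=; rewrite !in_itv /= => /andP[h1 h2].
    by rewrite (ltW h1) (le_trans h2) // xle.
  by rewrite h2 (le_trans (x0n n _)) // ltW.
- by move=> y _; rewrite lee_fin.
- apply/disj_set2P; rewrite -subset0 => y []/=; rewrite !in_itv /= => /andP[_ h1].
  by move=> /andP[h2 _]; move: (le_lt_trans h1 h2); rewrite ltxx.
rewrite big_ord_recr EFinD; apply: leeD.
  apply: IH => [j jn||j jn]; first by apply: xle; exact: ltnW.
    apply: measurable_funS mh => //= y /=; rewrite !in_itv /= => /andP[-> h2].
    by rewrite (le_trans h2) // xle.
  by apply: hV; exact: ltnW.
apply: le_trans (hV n (ltnSn n)).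
apply: ge0_subset_integral => //=.
- apply/measurable_EFinP; apply: mh' => //= y /=; rewrite !in_itv /= => /andP[h1 ->].
  by rewrite (le_trans (x0n n _) h1).
- by move=> y _; rewrite lee_fin.
- exact: subset_itv_oc_cc.
Qed.

Lemma sum_by_parity (R : realType) (c : bool -> R) (n : nat) :
  \sum_(j < n) c (odd j) = (uphalf n)%:R * c false + (n./2)%:R * c true.
Proof.
elim: n => [|n IH]; first by rewrite big_ord0 /= !mul0r addr0.
rewrite big_ord_recr /= IH uphalf_half; case: (odd n) => /=.
  by rewrite add1n -natr1; ring.
by rewrite add0n -natr1; ring.
Qed.

Lemma sin_add_npi (R : realType) (x : R) (j : nat) :
  sin (x + j%:R * pi) = (-1) ^+ j * sin x.
Proof.
elim: j => [|j IH]; first by rewrite mul0r addr0 expr0 mul1r.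
have -> : x + j.+1%:R * pi = (x + j%:R * pi) + pi by rewrite -natr1; ring.
by rewrite sinDpi IH exprS mulN1r mulNr.
Qed.

(** * Position of the nodes relative to the zeros of sin (n x) *)

Section NodePhase.
Context {R : realType}.
Variables (n : nat) (a b : R).
Hypotheses (n2 : (2 <= n)%N) (a0 : 0 < a) (b0 : 0 < b).
Hypothesis ratio : (uphalf n)%:R / a + (n./2)%:R / b = 1.

Let N : R := n%:R.
Let p : R := (uphalf n)%:R.
Let q : R := (n./2)%:R.

Let nE : N = p + q.
Proof. by rewrite /N /p /q -natrD uphalf_half -addnA addnn odd_double_half. Qed.

Let q0 : 0 < q.
Proof. by rewrite /q ltr0n half_gt0. Qed.

Let aN0 : a != 0. Proof. by rewrite gt_eqF. Qed.
Let bN0 : b != 0. Proof. by rewrite gt_eqF. Qed.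
Let qN0 : q != 0. Proof. by rewrite gt_eqF. Qed.

(** In units of pi, the phase of sin (N x) gained over the bumps of frequency [b] equals the phase
    lost over those of frequency [a]. *)
Let defect : q * (N - b) / b = p * (a - N) / a.
Proof.
have -> : q * (N - b) / b = N * (q / b) - q by field.
have -> : p * (a - N) / a = p - N * (p / a) by field.
have -> : q / b = 1 - p / a by rewrite -ratio /p /q; ring.
by rewrite nE; ring.
Qed.

(** Phase error of sin (N x) at the j-th node, measured from its own j-th zero j pi / N. *)
Definition node_phase (j : nat) : R := N * node a b j - j%:R * pi.

(** By [defect], a positive bump followed by a negative one shifts the phase by a nonnegative
    multiple of a - N, proportional to (p - q) / q. At an odd node the extra positive bump
    contributes the opposite sign and dominates the k complete pairs. *)
Lemma node_phase_sign (j : nat) : (j <= n)%N ->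
  exists2 r, 0 <= r & node_phase j = (-1) ^+ j * r * (a - N).
Proof.
move=> jn; set k := j./2.
have jE : j%:R = (odd j)%:R + 2 * k%:R :> R.
  by rewrite -{1}(odd_double_half j) natrD -muln2 natrM mulrC.
(* [p - q] is 0 or 1 according to the parity of n, so this reduces to k <= q. *)
have pqk : k%:R * (p - q) <= q.
  have -> : p = (odd n)%:R + q by rewrite /p /q uphalf_half natrD.
  rewrite addrK /q -natrM ler_nat.
  by case: (odd n); rewrite ?muln0 // muln1; exact: half_leq.
have pq : 0 <= p - q by rewrite subr_ge0 ler_nat uphalf_half leq_addl.
have p0 := pi_gt0 R.
have b' : N / b = 1 + p / q * (a - N) / a.
  have -> : N / b = 1 + (q * (N - b) / b) / q by field; rewrite qN0 bN0.
  by rewrite defect; field; rewrite aN0 qN0.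
have nodeE : node_phase j = (uphalf j)%:R * pi * (N / a)
    + k%:R * pi * (N / b) - j%:R * pi by rewrite /node_phase /node; ring.
case oj : (odd j).
  exists (pi / a * (1 - k%:R * (p - q) / q)).
    rewrite mulr_ge0 ?divr_ge0 ?(ltW p0) ?(ltW a0) // subr_ge0.
    by rewrite ler_pdivrMr // mul1r.
  rewrite nodeE b' jE -signr_odd oj expr1 uphalf_half oj /= natrD.
  by field; rewrite aN0 qN0.
exists (k%:R * pi * ((p - q) / q) / a).
  by rewrite !(divr_ge0, mulr_ge0) ?(ltW p0) ?(ltW a0) ?(ltW q0).
rewrite nodeE b' jE -signr_odd oj expr0 uphalf_half oj /= add0n.
by field; rewrite aN0 qN0.
Qed.

(** The deviations of [a] and [b] from N have opposite signs by [defect]. The pattern is that of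
    [node_phase_sign], which makes the sign conditions of [bump_correlation] hold on every bump. *)
Lemma bump_freq_sign (j : nat) :
  exists2 r, 0 < r & bump_freq a b j - N = (-1) ^+ j * r * (a - N).
Proof.
rewrite /bump_freq -signr_odd; case: (odd j).
  have p0 : 0 < p by rewrite ltr0n uphalf_gt0 (leq_trans _ n2).
  exists (p / q * b / a); first by rewrite !(divr_gt0, mulr_gt0).
  have : N - b = q * (N - b) / b * (b / q) by field; rewrite qN0 bN0.
  rewrite defect expr1 => E; rewrite -[LHS]opprB E.
  by field; rewrite qN0 aN0.
by exists 1 => //; rewrite expr0 !mul1r.
Qed.

Lemma node_correlation (j : nat) : (j < n)%N -> a != N ->
  let w := bump_freq a b j in
  pi / (w + N) * (1 - pi ^+ 2 * (w - N) ^+ 2 / (6 * w ^+ 2))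
  <= (-1) ^+ j * (w * (sin (N * node a b j) + sin (N * node a b j.+1))
                    / (w ^+ 2 - N ^+ 2)).
Proof.
move=> jn aN /=; set w := bump_freq a b j.
have w0 : 0 < w := bump_freq_gt0 j a0 b0.
have N0 : 0 < N by rewrite ltr0n ltnW.
have [k k0 wE] := bump_freq_sign j.
have [r r0 rE] := node_phase_sign (ltnW jn).
have [r' r'0 r'E] := node_phase_sign jn.
have sq : (-1 : R) ^+ j * (-1) ^+ j = 1 by rewrite -expr2 sqrr_sign.
have aN2 : 0 <= (a - N) ^+ 2 by exact: sqr_ge0.
have wN : w != N.
  by rewrite -subr_eq0 wE !mulf_neq0 ?signr_eq0 ?subr_eq0 // gt_eqF.
(* The minus sign at the right end comes from the extra pi in the shift by j + 1; the two phases
   then add up to pi (w - N) / w because the bump has width pi / w. *)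
have := @bump_correlation R w N (node_phase j) (- node_phase j.+1) w0 N0 wN.
have -> : (-1) ^+ j * (w * (sin (N * node a b j) + sin (N * node a b j.+1))
    / (w ^+ 2 - N ^+ 2))
  = w * (sin (node_phase j) + sin (- node_phase j.+1)) / (w ^+ 2 - N ^+ 2).
  have -> : N * node a b j = node_phase j + j%:R * pi by rewrite /node_phase subrK.
  have -> : N * node a b j.+1 = node_phase j.+1 + j.+1%:R * pi.
    by rewrite /node_phase subrK.
  rewrite !sin_add_npi sinN exprS.
  transitivity ((-1) ^+ j * (-1) ^+ j *
   (w * (sin (node_phase j) - sin (node_phase j.+1)) / (w ^+ 2 - N ^+ 2))).
    by ring.
  by rewrite sq mul1r.
apply.
- rewrite rE wE.
  have -> : (-1) ^+ j * r * (a - N) * ((-1) ^+ j * k * (a - N))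
    = (-1) ^+ j * (-1) ^+ j * (r * k * (a - N) ^+ 2) by ring.
  by rewrite sq mul1r; exact: (mulr_ge0 (mulr_ge0 r0 (ltW k0)) aN2).
- rewrite r'E wE exprS.
  have -> : - (-1 * (-1) ^+ j * r' * (a - N)) * ((-1) ^+ j * k * (a - N))
    = (-1) ^+ j * (-1) ^+ j * (r' * k * (a - N) ^+ 2) by ring.
  by rewrite sq mul1r; exact: (mulr_ge0 (mulr_ge0 r'0 (ltW k0)) aN2).
- rewrite /node_phase nodeS -/w -natr1; field.
  by rewrite gt_eqF.
Qed.

End NodePhase.

(** The relation is the branch a > p of the hyperbola (a - p) (b - q) = p q, which decreases through
    (p + q, p + q). *)
Lemma ratio_sides (R : realFieldType) (p q a b : R) :
  0 < p -> 0 < q -> 0 < a -> 0 < b -> p / a + q / b = 1 ->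
  (p + q <= a -> b <= p + q) /\ (a <= p + q -> p + q <= b).
Proof.
move=> p0 q0 a0 b0 h.
have {}h : p * b + q * a = a * b.
  have : (p / a + q / b) * (a * b) = a * b by rewrite h mul1r.
  by move=> <-; field; rewrite !gt_eqF.
have hp : (a - p) * (b - q) = p * q.
  have -> : (a - p) * (b - q) = a * b - (p * b + q * a) + p * q by ring.
  by rewrite h subrr add0r.
have ap : 0 < a - p.
  have : 0 < (a - p) * b by have := mulr_gt0 q0 a0; lra.
  by rewrite pmulr_lgt0.
split=> ha; rewrite leNgt; apply/negP => hb.
  have : q * (b - q) <= (a - p) * (b - q) by rewrite ler_wpM2r //; lra.
  have : q * p < q * (b - q) by rewrite ltr_pM2l //; lra.
  by lra.
have : (a - p) * (b - q) < (a - p) * p by rewrite ltr_pM2l //; lra.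
have : (a - p) * p <= q * p by rewrite ler_wpM2r //; lra.
by lra.
Qed.

Definition fucik_const (R : realType) (n : nat) (al be : R) : R :=
  if ~~ odd n then 8
  else if be <= al then 8 * n%:R ^+ 2 * (n%:R ^+ 2 + 1) / (n%:R - 1) ^+ 4
  else 10 * n%:R ^+ 2 * (n%:R ^+ 2 + 1) / (n%:R + 1) ^+ 4.

(** Supplies the hypothesis on [kap] in [fucik_distance_bound]. For even n it reads 7 q^4 <= 8 q^4,
    and for odd n it also holds with kap = 1. *)
Lemma narrow_positive_const (R : realType) (n : nat) (al be : R) : (2 <= n)%N ->
  be <= al -> exists kap : R,
  let p := (uphalf n)%:R in let q := (n./2)%:R in
  (p * n%:R + 5 * p * q) * q ^+ 2 <= kap * (p ^+ 2 + q ^+ 2) * n%:R ^+ 2 /\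
  kap * (p ^+ 2 + q ^+ 2) * n%:R ^+ 2 / q ^+ 4 = fucik_const n al be.
Proof.
move=> n2 h; exists 1 => p q.
have q1 : 1 <= q by rewrite ler1n half_gt0.
have pE : p = (odd n)%:R + q by rewrite /p /q uphalf_half natrD.
have nE : n%:R = (odd n)%:R + 2 * q :> R.
  by rewrite /q -{1}(odd_double_half n) natrD -muln2 natrM mulrC.
have qN0 : q != 0 by rewrite gt_eqF // (lt_le_trans ltr01).
rewrite /fucik_const h pE nE; case: (odd n) => /=.
  split.
    have q2 : 0 <= q ^+ 2 by exact: sqr_ge0.
    have q3 : 0 <= q ^+ 3 by rewrite exprn_ge0 // (le_trans ler01).
    have q4 : 0 <= q ^+ 4 by rewrite exprn_ge0 // (le_trans ler01).
    by nra.
  have -> : 1 + 2 * q - 1 = 2 * q by ring.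
  by field; rewrite qN0.
rewrite add0r; split; last by field; rewrite qN0.
have : 0 <= q ^+ 4 by rewrite exprn_ge0 // (le_trans ler01).
by nra.
Qed.

Lemma narrow_negative_const (R : realType) (n : nat) (al be : R) : (2 <= n)%N ->
  al < be -> exists kap : R,
  let p := (uphalf n)%:R in let q := (n./2)%:R in
  (q * n%:R + 5 * q * p) * p ^+ 2 <= kap * (q ^+ 2 + p ^+ 2) * n%:R ^+ 2 /\
  kap * (q ^+ 2 + p ^+ 2) * n%:R ^+ 2 / p ^+ 4 = fucik_const n al be.
Proof.
(* The wide bumps are now the p positive ones. For odd n and kap = 1, right minus left is q^4 - 4
   q^3 - 5 q^2 + 1, negative for n = 3, 5, 7, 9; kap = 5 / 4 works for every odd n. *)
move=> n2 h; exists (if odd n then 5 / 4 else 1) => p q.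
have q1 : 1 <= q by rewrite ler1n half_gt0.
have pE : p = (odd n)%:R + q by rewrite /p /q uphalf_half natrD.
have nE : n%:R = (odd n)%:R + 2 * q :> R.
  by rewrite /q -{1}(odd_double_half n) natrD -muln2 natrM mulrC.
have qN0 : q != 0 by rewrite gt_eqF // (lt_le_trans ltr01).
have q1N0 : 1 + q != 0 by rewrite gt_eqF // addr_gt0 // (lt_le_trans ltr01).
rewrite /fucik_const (lt_geF h) pE nE; case: (odd n) => /=.
  split.
    have q2 : 0 <= (q - 1) * q ^+ 2.
      by rewrite mulr_ge0 ?subr_ge0 // exprn_ge0 // (le_trans ler01).
    have q3 : 0 <= (q - 1) * q ^+ 3.
      by rewrite mulr_ge0 ?subr_ge0 // exprn_ge0 // (le_trans ler01).
    by nra.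
  have -> : 1 + 2 * q + 1 = 2 * (1 + q) by ring.
  by field; rewrite q1N0.
rewrite add0r; split; last by field; rewrite qN0.
have : 0 <= q ^+ 4 by rewrite exprn_ge0 // (le_trans ler01).
by nra.
Qed.

Section FucikDistance.
Context {R : realType}.
Variables (n : nat) (al be : R) (f : R -> R).
Hypotheses (n2 : (2 <= n)%N) (curve : fucik_curve n (al, be)).
Hypothesis nf : normalized_fucik_eigenfunction n al be f.

Let a := Num.sqrt al.
Let b := Num.sqrt be.
Let N : R := n%:R.
Let p : R := (uphalf n)%:R.
Let q : R := (n./2)%:R.

Let al0 : 0 < al. Proof. by case: curve. Qed.
Let be0 : 0 < be. Proof. by case: curve. Qed.
Let a0 : 0 < a. Proof. by rewrite sqrtr_gt0. Qed.
Let b0 : 0 < b. Proof. by rewrite sqrtr_gt0. Qed.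
Let p0 : 0 < p. Proof. by rewrite ltr0n uphalf_gt0 ltnW. Qed.
Let q0 : 0 < q. Proof. by rewrite ltr0n half_gt0. Qed.
Let nE : N = p + q.
Proof. by rewrite /N /p /q -natrD uphalf_half -addnA addnn odd_double_half. Qed.
Let N0 : 0 < N. Proof. by rewrite nE addr_gt0. Qed.
Let ratio : p / a + q / b = 1. Proof. exact: sqrt_curve_ratio. Qed.
Let aN0 : a != 0. Proof. by rewrite gt_eqF. Qed.
Let bN0 : b != 0. Proof. by rewrite gt_eqF. Qed.

Lemma fucik_max_ge : N <= Num.max a b.
Proof.
have [_ h2] := ratio_sides p0 q0 a0 b0 ratio; rewrite le_max.
by have [//|/ltW aN] := leP N a; rewrite nE h2 // -nE.
Qed.

Let nodepi : node a b n = pi.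
Proof.
transitivity (pi * (p / a + q / b)); last by rewrite ratio mulr1.
by rewrite /node /p /q; ring.
Qed.

Lemma measurable_fucik_diff (k : R) :
  measurable_fun `[0, pi] (fun x => (f x - sin (k * x)) ^+ 2).
Proof.
have [cf _] := normalized_fucik_explicit n2 curve nf.
apply: subspace_continuous_measurable_fun => //.
apply/subspace_continuousP => x xI.
move/subspace_continuousP : cf => /(_ x xI) cf.
have cs : sin (k * y) @[y --> within `[0, pi] (nbhs x)] --> sin (k * x).
  apply: cvg_within_filter.
  have H : derivable (fun y : R => sin (k * y)) x 1 by apply: ex_derive.
  apply: (differentiable_continuous (f := fun y : R => sin (k * y))).
  exact/derivable1_diffP.
by apply: cvgM; apply: cvgB.
Qed.

(** Bound for one bump without its telescoping part. It depends on the bump only through the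
    frequency, so the sum only needs the number of bumps of each kind. *)
Let piece (w : R) : R :=
  (Num.min a b / w) ^+ 2 * (pi / (2 * w)) + pi / (2 * w)
  - 2 * (Num.min a b / w)
    * (pi / (w + N) * (1 - pi ^+ 2 * (w - N) ^+ 2 / (6 * w ^+ 2))).

Let S (x : R) : R := sin (2 * N * x) / (4 * N).

Let fucik_piece_integral (j : nat) : (j < n)%N -> a != N ->
  (\int[@lebesgue_measure R]_(x in `[node a b j, node a b j.+1])
     ((f x - sin (N * x)) ^+ 2)%:E
   <= (piece (bump_freq a b j) - (S (node a b j.+1) - S (node a b j)))%:E)%E.
Proof.
move=> jn aN; set w := bump_freq a b j.
have w0 : 0 < w := bump_freq_gt0 j a0 b0.
have [_ /(_ j jn) fE] := normalized_fucik_explicit n2 curve nf.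
have [k k0 wE] := bump_freq_sign n2 a0 b0 ratio j.
have wN : w != N.
  by rewrite -subr_eq0 wE !mulf_neq0 ?signr_eq0 ?subr_eq0 // gt_eqF.
set C := (-1) ^+ j * (Num.min a b / w).
have -> : (\int[@lebesgue_measure R]_(x in `[node a b j, node a b j.+1])
     ((f x - sin (N * x)) ^+ 2)%:E
   = \int[@lebesgue_measure R]_(x in `[node a b j, node a b j.+1])
     ((C * sin (w * (x - node a b j)) - sin (N * x)) ^+ 2)%:E)%E.
  by apply: eq_integral => x; rewrite inE /= => xI; rewrite fE.
rewrite nodeS (bump_integral C _ w0 N0 wN) -nodeS lee_fin.
have -> : C ^+ 2 = (Num.min a b / w) ^+ 2 by rewrite /C exprMn sqrr_sign mul1r.
have := node_correlation n2 a0 b0 ratio jn aN.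
rewrite /= -/w -/N /piece /C.
set Q := sin (N * node a b j) + _.
have -> : 2 * ((-1) ^+ j * (Num.min a b / w)) * (w * Q / (w ^+ 2 - N ^+ 2))
  = 2 * (Num.min a b / w) * ((-1) ^+ j * (w * Q / (w ^+ 2 - N ^+ 2))) by ring.
have m0 : 0 <= 2 * (Num.min a b / w).
  by rewrite mulr_ge0 // divr_ge0 ?(ltW w0) // le_min !ltW.
move=> /(ler_wpM2l m0); rewrite /S.
set X := 2 * _ * _; set Y := 2 * _ * _.
by lra.
Qed.

Let fucik_pieces_sum :
  p * piece a + q * piece b = pi / 2 *
   (p * ((Num.min a b / a) ^+ 2 / a - 4 * (Num.min a b / a) / (a + N)
           * (1 - pi ^+ 2 * (a - N) ^+ 2 / (6 * a ^+ 2)))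
    + q * ((Num.min a b / b) ^+ 2 / b - 4 * (Num.min a b / b) / (b + N)
           * (1 - pi ^+ 2 * (b - N) ^+ 2 / (6 * b ^+ 2))) + (p / a + q / b)).
Proof.
have aD : a + N != 0 by rewrite gt_eqF // addr_gt0.
have bD : b + N != 0 by rewrite gt_eqF // addr_gt0.
rewrite /piece; field.
by rewrite aD bD aN0 bN0.
Qed.

Let fucik_pieces_bound : p * piece a + q * piece b
  <= pi / 2 * fucik_const n al be * ((Num.max a b - N) / N) ^+ 2.
Proof.
rewrite fucik_pieces_sum ratio -[leRHS]mulrA ler_pM2l ?divr_gt0 ?pi_gt0 //.
have w0 : 0 <= pi ^+ 2 :> R by exact: sqr_ge0.
have w1 : pi ^+ 2 <= 256 / 25 :> R.
  by have := pi_lt_16fifth R; have := pi_gt0 R; nra.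
have q1 : 1 <= q by rewrite ler1n half_gt0.
have pE : p = (odd n)%:R + q by rewrite /p /q uphalf_half natrD.
have [pq qp] : p <= 2 * q /\ q <= 2 * p by rewrite pE; case: odd => /=; split; lra.
have [h1 h2] := ratio_sides p0 q0 a0 b0 ratio.
rewrite -nE in h1 h2.
have [ba|ab] := leP be al.
  have bas : b <= a by rewrite ler_wsqrtr.
  have Na : N <= a by move: fucik_max_ge; rewrite (max_idPl bas).
  rewrite (min_idPr bas) (max_idPl bas).
  have [kap [hk <-]] := narrow_positive_const n2 ba.
  have := fucik_distance_bound p0 q0 nE pq b0 (h1 Na) Na ratio w0 w1 hk.
  by rewrite divff // expr1n mul1r mulr1.
have abs : a <= b by rewrite ler_wsqrtr // ltW.
have Nb : N <= b by move: fucik_max_ge; rewrite (max_idPr abs).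
have aN : a <= N.
  by rewrite leNgt; apply/negP => Na; have := h1 (ltW Na); move=> bN; lra.
rewrite (min_idPl abs) (max_idPr abs).
have [kap [hk <-]] := narrow_negative_const n2 ab.
(* The narrow bumps are the negative ones here, so p, q and a, b exchange roles. *)
have nE' : N = q + p by rewrite addrC.
have ratio' : q / b + p / a = 1 by rewrite addrC.
have := fucik_distance_bound q0 p0 nE' qp a0 aN Nb ratio' w0 w1 hk.
rewrite divff // expr1n mul1r mulr1 => h.
by rewrite [X in X + 1]addrC.
Qed.

Lemma fucik_distance :
  (\int[@lebesgue_measure R]_(x in `]0%R, pi[) ((f x - sin (N * x)) ^+ 2)%:E
   <= (pi / 2 * fucik_const n al be * ((Num.max a b - N) / N) ^+ 2)%:E)%E.
Proof.
have m := measurable_fucik_diff N.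
have mo : measurable_fun `]0, pi[ (fun x => ((f x - sin (N * x)) ^+ 2)%:E).
  by apply/measurable_EFinP; apply: measurable_funS m => //; exact: subset_itv_oo_cc.
have -> : (\int[@lebesgue_measure R]_(x in `]0%R, pi[)
      ((f x - sin (N * x)) ^+ 2)%:E =
   \int[@lebesgue_measure R]_(x in `]node a b 0, node a b n])
      ((f x - sin (N * x)) ^+ 2)%:E)%E.
  by rewrite node0 nodepi (integral_itv_bndoo false false mo).
have mle j : (j < n)%N -> node a b j <= node a b j.+1 by move=> _; exact: node_le.
have sq0 x : 0 <= (f x - sin (N * x)) ^+ 2 by exact: sqr_ge0.
have mn : measurable_fun `[node a b 0, node a b n]
    (fun x => (f x - sin (N * x)) ^+ 2) by rewrite node0 nodepi.
(* Resonance is treated apart, since the bump formulas divide by w^2 - N^2. If a = N then b = N too,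
   and f is sin (N x) itself. *)
have [aN|aN] := eqVneq a N.
  have bE : b = N.
    have [h1 h2] := ratio_sides p0 q0 a0 b0 ratio; rewrite -nE aN in h1 h2.
    by apply/eqP; rewrite eq_le h1 // h2.
  rewrite [in leRHS]aN [in leRHS]bE maxxx subrr mul0r expr0n mulr0.
  rewrite (_ : 0 = \sum_(j < n) 0); last by rewrite big1.
  apply: (@integral_partition_le R _ (node a b) (fun=> 0)) => // j jn.
  rewrite integral0_eq // => x xj.
  have [_ /(_ j jn x xj) ->] := normalized_fucik_explicit n2 curve nf.
  have wE : bump_freq a b j = N by rewrite /bump_freq aN bE if_same.
  rewrite -/a -/b wE aN bE minxx divff ?gt_eqF // mulr1.
  have -> : node N N j = j%:R * (pi / N).
    rewrite /node -mulrDl; congr (_ * _).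
    by rewrite -natrD uphalf_half -addnA addnn odd_double_half.
  have -> : N * (x - j%:R * (pi / N)) = N * x - j%:R * pi.
    by field; rewrite gt_eqF.
  rewrite -[in sin (N * x)](subrK (j%:R * pi) (N * x)) sin_add_npi.
  by rewrite subrr expr0n.
apply: (le_trans (@integral_partition_le R _ (node a b)
  (fun j => piece (bump_freq a b j) - (S (node a b j.+1) - S (node a b j)))
  n mle sq0 mn _)); first by move=> j jn; exact: fucik_piece_integral.
rewrite lee_fin sumrB -(big_mkord xpredT (fun j => S (node a b j.+1) - S (node a b j)))
  telescope_sumr //.
rewrite nodepi node0 /S mulr0 sin0 mul0r subr0.
have -> : sin (2 * N * pi) = 0 :> R.
  have -> : 2 * N * pi = 0 + (2 * n)%:R * pi :> R by rewrite natrM add0r.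
  by rewrite sin_add_npi sin0 mulr0.
rewrite mul0r subr0; apply: le_trans fucik_pieces_bound.
by rewrite (sum_by_parity (fun o => piece (if o then b else a))).
Qed.

End FucikDistance.

(** * The space L^2(0, pi) *)

Section L2.
Context {R : realType}.
Implicit Types (g h : R -> R) (psi : nat -> R -> R) (a : nat -> R).
Let mu := @lebesgue_measure R.
Let D : set R := `]0, pi[%classic.

Lemma L2_norm_sqr g :
  (L2_norm g ^+ 2 = \int[mu]_(x in D) ((g x) ^+ 2)%:E)%E.
Proof.
rewrite /L2_norm unlock poweR12_sqrt; last first.
  by apply: integral_ge0 => x _; exact: poweR_ge0.
rewrite sqr_sqrte; last by apply: integral_ge0 => x _; exact: poweR_ge0.
rewrite [RHS]integral_mkcond; apply: eq_integral => x _ /=.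
rewrite /patch; case: ifPn => _ /=.
  by rewrite powR_mulrn // real_normK // num_real.
by rewrite normr0 powR0 // pnatr_eq0.
Qed.

Lemma L2_norm_ge0 g : (0 <= L2_norm g)%E.
Proof. exact: Lnorm_ge0. Qed.

Lemma in_L2P g : in_L2 g <-> measurable_fun D g /\ (L2_norm g < +oo)%E.
Proof.
have mD : measurable D by exact: measurable_itv.
rewrite /in_L2 inE; split.
  case/andP; rewrite !inE /= => mg fg; split => //.
  exact: (measurable_restrictT g mD).2.
case=> mg fg; apply/andP; rewrite !inE /=; split => //.
exact: (measurable_restrictT g mD).1.
Qed.

Lemma restrictD_fun g h : (fun x => g x + h x) \_ D = g \_ D \+ h \_ D.
Proof.
apply/funext => x; rewrite /patch /=; case: ifP => //=; by rewrite addr0.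
Qed.

Lemma L2_normD g h : in_L2 g -> in_L2 h ->
  (L2_norm (fun x => g x + h x)%R <= L2_norm g + L2_norm h)%E.
Proof.
move=> /in_L2P[mg _] /in_L2P[mh _]; rewrite /L2_norm restrictD_fun.
have mD : measurable D by exact: measurable_itv.
apply: minkowski_EFin; last by rewrite ler1n.
- exact: (measurable_restrictT g mD).1.
- exact: (measurable_restrictT h mD).1.
Qed.

Lemma in_L2D g h : in_L2 g -> in_L2 h -> in_L2 (fun x => g x + h x).
Proof.
move=> Lg Lh; have := L2_normD Lg Lh; move: Lg Lh.
move=> /in_L2P[mg fg] /in_L2P[mh fh] t; apply/in_L2P; split.
  exact: measurable_funD.
by apply: (le_lt_trans t); rewrite lte_add_pinfty.
Qed.

Lemma L2_normZ (c : R) g : measurable_fun D g ->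
  (L2_norm (fun x => c * g x)%R = `|c|%:E * L2_norm g)%E.
Proof.
move=> mg; have mD : measurable D by exact: measurable_itv.
have sq : (L2_norm (fun x => c * g x)%R ^+ 2 = (`|c|%:E * L2_norm g) ^+ 2)%E.
  rewrite [RHS]expe2 muleACA -!expe2 !L2_norm_sqr.
  rewrite -EFin_expe real_normK ?num_real //.
  rewrite -ge0_integralZl_EFin ?sqr_ge0 //.
  - by apply: eq_integral => x _; rewrite exprMn EFinM.
  - by move=> x _; rewrite lee_fin sqr_ge0.
  - by apply/measurable_EFinP; exact: measurable_funX.
apply/eqP; rewrite eq_le; apply/andP; split.
- by apply: lee_sqrE; rewrite ?sq // mule_ge0 ?L2_norm_ge0 // lee_fin.
- by apply: lee_sqrE; rewrite ?sq // L2_norm_ge0.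
Qed.

Lemma in_L2Z (c : R) g : in_L2 g -> in_L2 (fun x => c * g x).
Proof.
move=> /in_L2P[mg fg]; apply/in_L2P; split.
  by apply: measurable_funM => //; exact: measurable_cst.
rewrite L2_normZ //; case: (L2_norm g) (L2_norm_ge0 g) fg => // r _ _.
by rewrite -EFinM ltry.
Qed.

Lemma in_L2B g h : in_L2 g -> in_L2 h -> in_L2 (fun x => g x - h x).
Proof.
move=> Lg Lh; have := in_L2D Lg (in_L2Z (-1) Lh).
by congr in_L2; apply/funext => x; rewrite mulN1r.
Qed.

Lemma L2_norm0 : L2_norm (fun=> 0 : R) = 0%E.
Proof.
apply/eqP; rewrite eq_le L2_norm_ge0 andbT; apply: lee_sqrE => //.
rewrite L2_norm_sqr integral0_eq => [|x _]; first by rewrite expe2 mule0.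
by rewrite expr0n.
Qed.

Lemma in_L20 : in_L2 (fun=> 0 : R).
Proof. by apply/in_L2P; split; [exact: measurable_cst | rewrite L2_norm0]. Qed.

(** [fine] sends an infinite norm to 0, so this is meaningful only together with [in_L2]. *)
Definition l2n g : R := fine (L2_norm g).

Lemma l2nE g : in_L2 g -> L2_norm g = (l2n g)%:E.
Proof. by move=> /in_L2P[_ fg]; rewrite fineK // ge0_fin_numE ?L2_norm_ge0. Qed.

Lemma l2n_ge0 g : 0 <= l2n g.
Proof. by rewrite fine_ge0 // L2_norm_ge0. Qed.

Lemma l2nD g h : in_L2 g -> in_L2 h -> l2n (fun x => g x + h x) <= l2n g + l2n h.
Proof.
move=> Lg Lh; have := L2_normD Lg Lh.
by rewrite !l2nE // ?lee_fin //; exact: in_L2D.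
Qed.

Lemma l2nZ c g : in_L2 g -> l2n (fun x => c * g x) = `|c| * l2n g.
Proof.
move=> Lg; rewrite /l2n L2_normZ; last by case/in_L2P: Lg.
by rewrite l2nE // -EFinM.
Qed.

Lemma l2nB g h : in_L2 g -> in_L2 h -> l2n (fun x => g x - h x) <= l2n g + l2n h.
Proof.
move=> Lg Lh; have := l2nD Lg (in_L2Z (-1) Lh).
rewrite l2nZ // normrN1 mul1r.
by congr (l2n _ <= _); apply/funext => x; rewrite mulN1r.
Qed.

Lemma l2n_sqr g : in_L2 g -> ((l2n g ^+ 2)%:E = \int[mu]_(x in D) ((g x) ^+ 2)%:E)%E.
Proof. by move=> Lg; rewrite -L2_norm_sqr l2nE // EFin_expe. Qed.

Lemma eq_L2 g h : (forall x, x \in `]0, pi[ -> g x = h x) ->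
  g \_ D = h \_ D.
Proof.
move=> gh; apply/funext => x; rewrite /patch; case: ifPn => // xD.
by apply: gh; rewrite inE in xD.
Qed.

Lemma eq_in_L2 g h : (forall x, x \in `]0, pi[ -> g x = h x) ->
  in_L2 g -> in_L2 h.
Proof. by move=> /eq_L2 gh; rewrite /in_L2 -/D gh. Qed.

Lemma eq_L2_norm g h : (forall x, x \in `]0, pi[ -> g x = h x) ->
  L2_norm g = L2_norm h.
Proof. by move=> /eq_L2 gh; rewrite /L2_norm -/D gh. Qed.

Lemma in_L2_sqr_le g (c : R) : measurable_fun D g -> 0 <= c ->
  (\int[mu]_(x in D) ((g x) ^+ 2)%:E <= (c ^+ 2)%:E)%E ->
  in_L2 g /\ l2n g <= c.
Proof.
move=> mg c0 gc; have H : (L2_norm g <= c%:E)%E.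
  by apply: lee_sqrE; rewrite ?lee_fin // L2_norm_sqr -EFin_expe.
have Lg : in_L2 g by apply/in_L2P; split => //; rewrite (le_lt_trans H) // ltry.
by split => //; rewrite -lee_fin -l2nE.
Qed.

Lemma in_L2_bounded g (M : R) : measurable_fun D g -> 0 <= M ->
  (forall x, x \in `]0, pi[ -> `|g x| <= M) ->
  in_L2 g.
Proof.
move=> mg M0 gM; have mD : measurable D by exact: measurable_itv.
suff [] : in_L2 g /\ l2n g <= M * Num.sqrt pi by [].
apply: in_L2_sqr_le => //; first by rewrite mulr_ge0 ?sqrtr_ge0.
rewrite exprMn sqr_sqrtr ?pi_ge0 //.
apply: (@le_trans _ _ (\int[mu]_(x in D) (M ^+ 2)%:E)%E).
  apply: ge0_le_integral => //.
  - by move=> x _; rewrite lee_fin sqr_ge0.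
  - by apply/measurable_EFinP; exact: measurable_funX.
  - move=> x xD; rewrite lee_fin -real_normK ?num_real //.
    by rewrite lerXn2r ?nnegrE //; exact: gM.
have muD : mu D = pi%:E.
  by rewrite /mu /D lebesgue_measure_itv /= lte_fin pi_gt0 oppr0 adde0.
have -> : (\int[mu]_(x in D) (M ^+ 2)%:E = (M ^+ 2)%:E * mu D)%E.
  exact: integral_cst.
by rewrite muD -EFinM.
Qed.

Lemma in_L2_sum psi a (s : seq nat) : (forall k, k \in s -> in_L2 (psi k)) ->
  in_L2 (fun x => \sum_(k <- s) a k * psi k x) /\
  l2n (fun x => \sum_(k <- s) a k * psi k x) <= \sum_(k <- s) `|a k| * l2n (psi k).
Proof.
elim: s => [_|k s IH H].
  have -> : (fun x => \sum_(k <- [::]) a k * psi k x) = fun=> 0 :> R.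
    by apply/funext => x; rewrite big_nil.
  split; first exact: in_L20.
  by rewrite big_nil /l2n L2_norm0.
have [Ls ls] := IH (fun j js => H j (@mem_behead _ (k :: s) j js)).
have Lk : in_L2 (psi k) by apply: H; rewrite mem_head.
have -> : (fun x => \sum_(j <- k :: s) a j * psi j x)
  = fun x => a k * psi k x + \sum_(j <- s) a j * psi j x.
  by apply/funext => x; rewrite big_cons.
split; first by apply: in_L2D => //; exact: in_L2Z.
apply: (le_trans (l2nD (in_L2Z (a k) Lk) Ls)).
by rewrite big_cons l2nZ // lerD2l.
Qed.

Lemma in_L2_lincomb psi a N : (forall n, (1 <= n)%N -> in_L2 (psi n)) ->
  in_L2 (lincomb psi a N) /\
  l2n (lincomb psi a N) <= \sum_(1 <= n < N.+1) `|a n| * l2n (psi n).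
Proof.
move=> H; apply: in_L2_sum => k; rewrite mem_index_iota => /andP[k1 _].
exact: H.
Qed.

End L2.

(** * Orthogonality of the sines *)

Definition sine (R : realType) (n : nat) (x : R) : R := sin (n%:R * x).

Lemma continuous_sine (R : realType) (n : nat) : continuous (@sine R n).
Proof.
have H : forall x : R, derivable (fun x : R => sin (n%:R * x)) x 1.
  by move=> x; apply: ex_derive.
by move=> x; apply: differentiable_continuous; apply/derivable1_diffP; exact: H.
Qed.

Lemma lincombS (R : realType) (psi : nat -> R -> R) (a : nat -> R) (N : nat) (x : R) :
  lincomb psi a N.+1 x = lincomb psi a N x + a N.+1 * psi N.+1 x.
Proof. by rewrite /lincomb big_nat_recr. Qed.

Lemma lincomb0 (R : realType) (psi : nat -> R -> R) (a : nat -> R) (x : R) :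
  lincomb psi a 0 x = 0.
Proof. by rewrite /lincomb big_geq. Qed.

Lemma continuous_lincomb (R : realType) (psi : nat -> R -> R) (a : nat -> R) (N : nat) :
  (forall n, continuous (psi n)) -> continuous (lincomb psi a N).
Proof.
move=> cpsi; elim: N => [|N IH] x.
  by rewrite (_ : lincomb _ _ _ = cst 0); [exact: cst_continuous |
    apply/funext => y; rewrite lincomb0].
rewrite (_ : lincomb _ _ _ = fun y => lincomb psi a N y + a N.+1 * psi N.+1 y).
  by apply: cvgD; [exact: IH | apply: cvgM; [exact: cvg_cst | exact: cpsi]].
by apply/funext => y; rewrite lincombS.
Qed.

Lemma in_L2_continuous (R : realType) (g : R -> R) : continuous g -> in_L2 g.
Proof.
move=> cg.
have mg : measurable_fun `]0, pi[ g.
  by apply: measurable_funTS; exact: continuous_measurable_fun.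
have [M [_ HM]] := @compact_bounded _ _ _ (continuous_compact
  (continuous_subspaceT cg) (@segment_compact R 0 pi)).
have M0 : 0 <= `|M| + 1 by rewrite addr_ge0.
apply: (in_L2_bounded mg M0) => x xI.
apply: (HM (`|M| + 1)); first by rewrite (le_lt_trans (ler_norm _)) // ltrDl.
by exists x => //=; exact: subset_itv_oo_cc.
Qed.

(** Orthogonality in terms of primitives: they add up under linear combinations, and the fundamental
    theorem is applied once, to the square of a whole combination. *)
Lemma sine_lincomb_cross (R : realType) (a : nat -> R) (N m : nat) : (N < m)%N ->
  exists F : R -> R,
    (forall x : R, is_derive x 1 F (lincomb (@sine R) a N x * sine m x)) /\
    F pi - F 0 = 0.
Proof.
move=> Nm; elim: N => [|N IH] in Nm *.
  exists (cst 0); split => [x|]; last by rewrite subrr.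
  by rewrite lincomb0 mul0r; exact: is_derive_cst.
have [F [dF F0]] := IH (ltnW Nm).
pose k : R := N.+1%:R; pose l : R := m%:R.
have kl : k ^+ 2 - l ^+ 2 != 0.
  by rewrite subr_eq0 -!natrX eqr_nat eqn_exp2r // neq_ltn Nm.
pose T (x : R) := (l * sin (k * x) * cos (l * x) - k * cos (k * x) * sin (l * x))
    / (k ^+ 2 - l ^+ 2).
have dT (x : R) : is_derive x 1 T (sin (k * x) * sin (l * x)).
  by apply: is_derive_eq; rewrite /GRing.scale /=; field; rewrite ?[1 + _]addrC ?natr1.
exists (fun x => F x + a N.+1 * T x); split.
  move=> x; have := dF x => dFx; have := dT x => dTx.
  by apply: is_derive_eq; rewrite lincombS /sine -/k -/l /GRing.scale /=; ring.
have sk (j : nat) : sin (j%:R * pi) = 0 :> R.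
  by rewrite -[X in sin X]add0r sin_add_npi sin0 mulr0.
rewrite /T !sk !mulr0 sin0 !(mulr0, mul0r) subrr mul0r mulr0 !addr0.
exact: F0.
Qed.

Lemma sine_lincomb_primitive (R : realType) (a : nat -> R) (N : nat) :
  exists F : R -> R,
    (forall x : R, is_derive x 1 F (lincomb (@sine R) a N x ^+ 2)) /\
    F pi - F 0 = pi / 2 * \sum_(1 <= n < N.+1) a n ^+ 2.
Proof.
elim: N => [|N [F [dF F0]]].
  exists (cst 0); split => [x|].
    by rewrite lincomb0 expr0n; exact: is_derive_cst.
  by rewrite subrr big_geq // mulr0.
have [G [dG G0]] := @sine_lincomb_cross R a N N.+1 (ltnSn N).
pose k : R := N.+1%:R.
have k0 : k != 0 by rewrite pnatr_eq0.
pose T (x : R) := x / 2 - sin (2 * (k * x)) / (4 * k).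
have dT (x : R) : is_derive x 1 T (sin (k * x) ^+ 2).
  apply: is_derive_eq; rewrite /GRing.scale /= cos_double.
  by move: (sin _) => *; field; rewrite ?[1 + _]addrC ?natr1.
exists (fun x => F x + 2 * a N.+1 * G x + a N.+1 ^+ 2 * T x); split.
  move=> x; have := dF x => dFx; have := dG x => dGx; have := dT x => dTx.
  by apply: is_derive_eq; rewrite lincombS /sine -/k /GRing.scale /=; ring.
have sk : sin (2 * (k * pi)) = 0 :> R.
  have -> : 2 * (k * pi) = 0 + (2 * N.+1)%:R * pi :> R by rewrite natrM add0r mulrA.
  by rewrite sin_add_npi sin0 mulr0.
rewrite big_nat_recr //= [RHS]mulrDr -F0.
have -> : G pi = G 0 by apply/eqP; rewrite -subr_eq0 G0.
by rewrite /T sk !mulr0 sin0; field; rewrite ?[1 + _]addrC ?natr1.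
Qed.

Lemma in_L2_sine (R : realType) (n : nat) : in_L2 (@sine R n).
Proof. exact/in_L2_continuous/continuous_sine. Qed.

Lemma l2n_sine_lincomb (R : realType) (a : nat -> R) (N : nat) :
  l2n (lincomb (@sine R) a N) ^+ 2 = pi / 2 * \sum_(1 <= n < N.+1) a n ^+ 2.
Proof.
have cl : continuous (lincomb (@sine R) a N).
  by apply: continuous_lincomb => n; exact: continuous_sine.
have [F [dF F0]] := sine_lincomb_primitive a N.
apply: EFin_inj; rewrite l2n_sqr; last exact: in_L2_continuous.
rewrite -F0.
have c2 : continuous (fun x => lincomb (@sine R) a N x ^+ 2).
  by move=> x; apply: cvgM; exact: cl.
rewrite -(integral_of_derivative (pi_gt0 R) dF c2).
rewrite (integral_itv_bndoo true false) //.
apply/measurable_EFinP; apply: measurable_funTS.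
exact: continuous_measurable_fun.
Qed.

(** * Perturbation of an orthogonal basis *)

Lemma cauchy_schwarz_sum (R : realFieldType) (x y : nat -> R) (s : seq nat) :
  (\sum_(k <- s) x k * y k) ^+ 2
  <= (\sum_(k <- s) x k ^+ 2) * (\sum_(k <- s) y k ^+ 2).
Proof.
elim: s => [|k s IH]; first by rewrite !big_nil expr0n mulr0.
rewrite !big_cons.
have : 0 <= \sum_(j <- s) x j ^+ 2 by apply: sumr_ge0 => *; exact: sqr_ge0.
have : 0 <= \sum_(j <- s) y j ^+ 2 by apply: sumr_ge0 => *; exact: sqr_ge0.
move: IH; move: (\sum_(j <- s) x j * y j) (\sum_(j <- s) x j ^+ 2)
  (\sum_(j <- s) y j ^+ 2) (x k) (y k) => S A B u v SAB B0 A0.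
(* Compared through squares: (2 u v S)^2 <= 4 (u^2 B) (A v^2) by induction, and this is at most (u^2
   B + A v^2)^2. *)
suff : 2 * (u * v * S) <= u ^+ 2 * B + A * v ^+ 2 by nra.
have P0 : 0 <= u ^+ 2 * B + A * v ^+ 2.
  by apply: addr_ge0; apply: mulr_ge0 => //; exact: sqr_ge0.
apply: (le_trans (ler_norm _)).
rewrite -(ler_sqr _ P0) ?nnegrE // real_normK ?num_real //.
have : (u * v) ^+ 2 * S ^+ 2 <= (u * v) ^+ 2 * (A * B).
  by apply: ler_wpM2l => //; exact: sqr_ge0.
have := sqr_ge0 (u ^+ 2 * B - A * v ^+ 2).
nra.
Qed.

Lemma lincombD (R : realType) (psi : nat -> R -> R) (a b : nat -> R) (N M : nat) :
  exists P c, forall x, lincomb psi c P x = lincomb psi a N x + lincomb psi b M x.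
Proof.
(* Coefficients beyond the length of a combination are arbitrary and must be set to 0 before both
   are extended to the same length. *)
pose cut (d : nat -> R) L n := if (n <= L)%N then d n else 0.
have ext d L L' x : (L <= L')%N -> lincomb psi (cut d L) L' x = lincomb psi d L x.
  elim: L' => [|L' IH]; first by rewrite leqn0 => /eqP ->; rewrite !lincomb0.
  rewrite leq_eqVlt => /orP[/eqP ->|].
    rewrite /lincomb !big_nat; apply: eq_bigr => n /andP[_ nL].
    by rewrite /cut -ltnS nL.
  by rewrite ltnS => LL'; rewrite lincombS IH // /cut ltnNge LL' mul0r addr0.
exists (maxn N M), (fun n => cut a N n + cut b M n) => x.
rewrite -(ext a N _ x (leq_maxl N M)) -(ext b M _ x (leq_maxr N M)).
by rewrite /lincomb -big_split; apply: eq_bigr => n _; rewrite mulrDl.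
Qed.

Section Perturbation.
Context {R : realType}.
Variables (psi phi : nat -> R -> R) (K lam : R).
Hypotheses (Lpsi : forall n, (1 <= n)%N -> in_L2 (psi n))
  (Lphi : forall n, (1 <= n)%N -> in_L2 (phi n)).
Hypotheses (K0 : 0 < K) (lam0 : 0 <= lam) (lam1 : lam < 1).
Hypothesis phi_norm : forall (a : nat -> R) N,
  l2n (lincomb phi a N) ^+ 2 = K * \sum_(1 <= n < N.+1) a n ^+ 2.
Hypothesis phi_complete : complete_system phi.
Hypothesis close : forall N,
  \sum_(1 <= n < N.+1) l2n (fun x => psi n x - phi n x) ^+ 2 <= K * lam ^+ 2.

Let Llpsi a N : in_L2 (lincomb psi a N) := (in_L2_lincomb a N Lpsi).1.
Let Llphi a N : in_L2 (lincomb phi a N) := (in_L2_lincomb a N Lphi).1.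

(** The triangle inequality and Cauchy-Schwarz bound the left side by the square root of (sum a_n^2)
    K lam^2, and K sum a_n^2 is the squared norm of the [phi] combination. *)
Lemma lincomb_close (a : nat -> R) N :
  l2n (fun x => lincomb psi a N x - lincomb phi a N x)
  <= lam * l2n (lincomb phi a N).
Proof.
have -> : (fun x => lincomb psi a N x - lincomb phi a N x)
  = lincomb (fun n x => psi n x - phi n x) a N.
  apply/funext => x; rewrite /lincomb -sumrB; apply: eq_bigr => n _.
  by rewrite mulrBr.
have Ld n : (1 <= n)%N -> in_L2 (fun x => psi n x - phi n x).
  by move=> n1; apply: in_L2B; [exact: Lpsi | exact: Lphi].
apply: (le_trans (in_L2_lincomb a N Ld).2).
set S := \sum_(_ <= _ < _) _.
have r0 : 0 <= lam * l2n (lincomb phi a N) by rewrite mulr_ge0 // l2n_ge0.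
apply: (le_trans (ler_norm _)).
rewrite -(ler_sqr _ r0) ?nnegrE // real_normK ?num_real //.
apply: (le_trans (cauchy_schwarz_sum _ _ _)).
rewrite exprMn phi_norm mulrA mulrC [lam ^+ 2 * K]mulrC.
have -> : \sum_(k <- index_iota 1 N.+1) `|a k| ^+ 2
  = \sum_(1 <= n < N.+1) a n ^+ 2.
  by apply: eq_bigr => n _; rewrite real_normK // num_real.
by apply: ler_wpM2r; [apply: sumr_ge0 => *; exact: sqr_ge0 | exact: close].
Qed.

(** Completeness without inverting an operator: approximate [g] by the [phi] system, reuse the
    coefficients with [psi], and the residual shrinks by a fixed factor below 1. Iterating on the
    residual gives density. *)
Let step (g : R -> R) : in_L2 g -> exists N a,
  l2n (fun x => g x - lincomb psi a N x) <= (1 + lam) / 2 * l2n g.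
Proof.
move=> Lg; have [g0|g0] := eqVneq (l2n g) 0.
  exists 0%N, (fun=> 0).
  rewrite (_ : (fun x => _) = g) ?g0 ?mulr0 //.
  by apply/funext => x; rewrite lincomb0 subr0.
have {}g0 : 0 < l2n g by rewrite lt_neqAle eq_sym g0 l2n_ge0.
(* The error is at most d + lam (|g| + d) <= lam |g| + 2 d, which this choice makes (1 + lam) / 2
   |g|. It is positive because the case of zero norm was set aside. *)
pose d := l2n g * (1 - lam) / 4.
have d0 : 0 < d by rewrite divr_gt0 // mulr_gt0 // subr_gt0.
have [N [a]] := phi_complete Lg d0.
have Lr : in_L2 (fun x => g x - lincomb phi a N x) by exact: in_L2B.
rewrite l2nE // lte_fin => hd; exists N, a.
set r := (fun x => g x - lincomb phi a N x) in Lr hd.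
pose s x := lincomb psi a N x - lincomb phi a N x.
have Ls : in_L2 s by exact: in_L2B.
have h1 : l2n (fun x => g x - lincomb psi a N x) <= l2n r + l2n s.
  rewrite (_ : (fun x => g x - _) = fun x => r x - s x); first exact: l2nB.
  by apply/funext => x; rewrite /r /s; ring.
have h2 : l2n (lincomb phi a N) <= l2n g + l2n r.
  rewrite [X in l2n X](_ : _ = fun x => g x - r x); first exact: l2nB.
  by apply/funext => x; rewrite /r; ring.
have h3 := lincomb_close a N; rewrite -/s in h3.
have : lam * l2n (lincomb phi a N) <= lam * (l2n g + d).
  by apply: ler_wpM2l => //; apply: (le_trans h2); rewrite lerD2l ltW.
have : lam * d <= d by rewrite ger_pMl // ltW.
have : 4 * d = l2n g * (1 - lam) by rewrite /d; field.
by lra.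
Qed.

Let iterated_step (g : R -> R) (k : nat) : in_L2 g -> exists N a,
  l2n (fun x => g x - lincomb psi a N x) <= ((1 + lam) / 2) ^+ k * l2n g.
Proof.
elim: k => [|k IH] Lg.
  exists 0%N, (fun=> 0); rewrite expr0 mul1r.
  rewrite (_ : (fun x => _) = g) //.
  by apply/funext => x; rewrite lincomb0 subr0.
have [N [a hN]] := IH Lg.
have Lr : in_L2 (fun x => g x - lincomb psi a N x) by exact: in_L2B.
have [M [b hM]] := step Lr.
have [P [c hP]] := lincombD psi a b N M.
exists P, c.
rewrite (_ : (fun x => _) = fun x => g x - lincomb psi a N x - lincomb psi b M x).
  apply: (le_trans hM); rewrite exprS -[leRHS]mulrA; apply: ler_wpM2l => //.
  by rewrite divr_ge0 // addr_ge0.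
by apply/funext => x; rewrite hP opprD addrA.
Qed.

Lemma perturbed_complete : complete_system psi.
Proof.
move=> g Lg e e0.
pose rho := (1 + lam) / 2.
have rho0 : 0 <= rho by rewrite divr_ge0 // addr_ge0.
have rho1 : rho < 1 by rewrite /rho; have := lam1; lra.
have [k hk] : exists k, rho ^+ k * l2n g < e.
  have : rho ^+ k * l2n g @[k --> \oo] --> 0 * l2n g.
    by apply: cvgMl; apply: cvg_expr; rewrite ger0_norm.
  rewrite mul0r => /cvgr_lt /(_ _ e0) [k _ hk]; exists k; exact: hk k (leqnn k).
have [N [a hN]] := iterated_step k Lg.
exists N, a; rewrite l2nE; last exact: in_L2B.
by rewrite lte_fin (le_lt_trans hN).
Qed.

Lemma perturbed_riesz_basis : riesz_basis psi.
Proof.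
split; [exact: Lpsi | exact: perturbed_complete |].
exists (K * (1 - lam) ^+ 2), (K * (1 + lam) ^+ 2).
have l1 : 0 < 1 - lam by rewrite subr_gt0.
have l2 : 0 < 1 + lam by rewrite ltr_wpDr.
split; rewrite ?mulr_gt0 ?exprn_gt0 // => N a.
have -> : \sum_(1 <= n < N.+1) `|a n| ^+ 2 = \sum_(1 <= n < N.+1) a n ^+ 2.
  by apply: eq_bigr => n _; rewrite real_normK // num_real.
rewrite l2nE // -EFin_expe !lee_fin.
have E c : K * c ^+ 2 * \sum_(1 <= n < N.+1) a n ^+ 2
  = (c * l2n (lincomb phi a N)) ^+ 2 by rewrite exprMn phi_norm; ring.
rewrite !E.
pose s x := lincomb psi a N x - lincomb phi a N x.
have Ls : in_L2 s by exact: in_L2B.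
have h3 : l2n s <= lam * l2n (lincomb phi a N) := lincomb_close a N.
have h1 : l2n (lincomb psi a N) <= l2n (lincomb phi a N) + l2n s.
  rewrite [X in l2n X <= _](_ : _ = fun x => lincomb phi a N x + s x); first exact: l2nD.
  by apply/funext => x; rewrite /s; ring.
have h2 : l2n (lincomb phi a N) <= l2n (lincomb psi a N) + l2n s.
  rewrite [X in l2n X <= _](_ : _ = fun x => lincomb psi a N x - s x); first exact: l2nB.
  by apply/funext => x; rewrite /s; ring.
have p0 := l2n_ge0 (lincomb phi a N); have q0 := l2n_ge0 (lincomb psi a N).
split; rewrite ler_sqr ?nnegrE ?mulr_ge0 ?(ltW l1) ?(ltW l2) //; lra.
Qed.

End Perturbation.

(** * Completeness of the sines *)

Definition sine_poly (R : realType) (h : R -> R) : Prop :=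
  exists N a, forall x, h x = lincomb (@sine R) a N x.

Section SinePoly.
Context {R : realType}.
Implicit Types (g h : R -> R).

Lemma sine_polyD g h : sine_poly g -> sine_poly h -> sine_poly (fun x => g x + h x).
Proof.
move=> [N [a ga]] [M [b hb]].
have [P [c H]] := lincombD (@sine R) a b N M.
by exists P, c => x; rewrite H ga hb.
Qed.

Lemma sine_polyZ (c : R) h : sine_poly h -> sine_poly (fun x => c * h x).
Proof.
move=> [N [a ha]]; exists N, (fun n => c * a n) => x.
by rewrite ha /lincomb mulr_sumr; apply: eq_bigr => n _; rewrite mulrA.
Qed.

Lemma sine_poly0 : sine_poly (fun=> 0 : R).
Proof. by exists 0%N, (fun=> 0) => x; rewrite lincomb0. Qed.

Lemma sine_poly_sine n : sine_poly (@sine R n).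
Proof.
case: n => [|n].
  rewrite (_ : sine 0 = fun=> 0); first exact: sine_poly0.
  by apply/funext => x; rewrite /sine mul0r sin0.
exists n.+1, (fun k => (k == n.+1)%:R) => x; rewrite lincombS eqxx mul1r.
rewrite /lincomb big_nat big1 ?add0r // => k /andP[_ kn].
by rewrite ltn_eqF // mul0r.
Qed.

Lemma sine_poly_sum (a : nat -> R) (psi : nat -> R -> R) N :
  (forall n, (1 <= n)%N -> sine_poly (psi n)) -> sine_poly (lincomb psi a N).
Proof.
move=> H; elim: N => [|N IH].
  rewrite (_ : lincomb _ _ _ = fun=> 0); first exact: sine_poly0.
  by apply/funext => x; rewrite lincomb0.
rewrite (_ : lincomb _ _ _ = fun x => lincomb psi a N x + a N.+1 * psi N.+1 x).
  by apply: sine_polyD => //; apply: sine_polyZ; exact: H.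
by apply/funext => x; rewrite lincombS.
Qed.

(** By 2 cos x sin (n x) = sin ((n + 1) x) + sin ((n - 1) x). For n = 1 the last term is [sine 0],
    the zero function, which [sine_poly_sine] includes. *)
Lemma sine_poly_cos h : sine_poly h -> sine_poly (fun x => cos x * h x).
Proof.
move=> [N [a ha]].
rewrite (_ : (fun x => _) = lincomb (fun n x => cos x * sine n x) a N).
  apply: sine_poly_sum => -[//|n] _.
  rewrite (_ : (fun x => _) = fun x => 2^-1 * (sine n.+2 x + sine n x)).
    apply: sine_polyZ; apply: sine_polyD; exact: sine_poly_sine.
  apply/funext => x; rewrite /sine.
  have -> : n.+2%:R * x = n.+1%:R * x + x by rewrite -natr1; ring.
  have -> : n%:R * x = n.+1%:R * x - x by rewrite -natr1; ring.
  by rewrite sinD sinB; field.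
apply/funext => x; rewrite ha /lincomb mulr_sumr.
by apply: eq_bigr => n _; ring.
Qed.

Lemma continuous_sine_poly h : sine_poly h -> continuous h.
Proof.
move=> [N [a ha]]; rewrite (_ : h = lincomb (@sine R) a N); last exact/funext.
by apply: continuous_lincomb => n; exact: continuous_sine.
Qed.

End SinePoly.

(* [bernstein y n g] is the expectation of [g] under the binomial law with
   parameters [n] and [y], i.e. the n-th Bernstein polynomial at [y] when
   [g k = f (k / n)]. *)
Fixpoint bernstein (R : realType) (y : R) (n : nat) (g : nat -> R) : R :=
  if n is n'.+1 then
    (1 - y) * bernstein y n' g + y * bernstein y n' (fun k => g k.+1)
  else g 0%N.

Section Bernstein.
Context {R : realType}.
Implicit Types (y c : R) (g h : nat -> R).

Lemma bernstein_affine y n c d g :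
  bernstein y n (fun k => c + d * g k) = c + d * bernstein y n g.
Proof.
elim: n g => [//|n IH] g /=; rewrite IH (IH (fun k => g k.+1)); ring.
Qed.

Lemma le_bernstein y n g h : 0 <= y -> y <= 1 -> (forall k, g k <= h k) ->
  bernstein y n g <= bernstein y n h.
Proof.
move=> y0 y1; elim: n g h => [|n IH] g h gh /=; first exact: gh.
by rewrite lerD // ler_wpM2l ?subr_ge0 // IH.
Qed.

(** Variance plus squared bias of a binomial variable. The centre [c] is arbitrary because the shift
    in the recursion replaces it by c - 1. *)
Lemma bernstein_variance y n c :
  bernstein y n (fun k => (k%:R - c) ^+ 2) = n%:R * y * (1 - y) + (n%:R * y - c) ^+ 2.
Proof.
elim: n c => [|n IH] c /=; first by ring.
have -> : (fun k => (k.+1%:R - c) ^+ 2) = fun k => (k%:R - (c - 1)) ^+ 2 :> R.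
  by apply/funext => k; rewrite -natr1; ring.
by rewrite !IH -natr1; ring.
Qed.

Lemma bernstein_norm_le y n g M : 0 <= y -> y <= 1 -> (forall k, `|g k| <= M) ->
  `|bernstein y n g| <= M.
Proof.
move=> y0 y1 gM; elim: n g gM => [|n IH] g gM /=; first exact: gM.
apply: (le_trans (ler_normD _ _)); rewrite !normrM (ger0_norm y0).
rewrite (@ger0_norm _ (1 - y)) ?subr_ge0 //.
have h1 : (1 - y) * `|bernstein y n g| <= (1 - y) * M.
  by rewrite ler_wpM2l ?subr_ge0 // IH.
have h2 : y * `|bernstein y n (fun k => g k.+1)| <= y * M by rewrite ler_wpM2l // IH.
by lra.
Qed.

(** Chebyshev's argument at a single point of continuity; dominated convergence later turns
    pointwise convergence into convergence in L^2. *)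
Lemma bernstein_cvg (f : R -> R) (y M : R) : 0 <= y -> y <= 1 ->
  (forall t, `|f t| <= M) -> {for y, continuous f} ->
  bernstein y n (fun k => f (k%:R / n%:R)) @[n --> \oo] --> f y.
Proof.
move=> y0 y1 fM cf; apply/cvgrPdist_lt => e e0.
have M0 : 0 <= M by apply: le_trans (fM 0).
have [d /= d0 hd] : exists2 d : R, 0 < d & forall t, `|y - t| < d -> `|f y - f t| < e / 2.
  have e2 : 0 < e / 2 by rewrite divr_gt0.
  by move/cvgrPdist_lt : cf => /(_ _ e2) /nbhs_ballP[d d0 hd]; exists d.
(* With this constant |f y - f t| <= e / 2 + L (t - y)^2 for all t: where |t - y| >= d the last term
   is at least 2 M. Averaging uses the variance y (1 - y) / n <= 1 / n. *)
pose L := 2 * M / d ^+ 2.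
have L0 : 0 <= L by apply: divr_ge0; [rewrite mulr_ge0 | exact: sqr_ge0].
have bound n : (0 < n)%N ->
    `|f y - bernstein y n (fun k => f (k%:R / n%:R))| <= e / 2 + L / n%:R.
  move=> n0; have n0' : 0 < n%:R :> R by rewrite ltr0n.
  pose w k := e / 2 + (L / n%:R ^+ 2) * (k%:R - n%:R * y) ^+ 2.
  have hw : bernstein y n w <= e / 2 + L / n%:R.
    rewrite /w bernstein_affine bernstein_variance subrr expr0n addr0 lerD2l.
    have -> : L / n%:R ^+ 2 * (n%:R * y * (1 - y)) = L / n%:R * (y * (1 - y)).
      by field; rewrite gt_eqF.
    apply: ler_piMr; first by rewrite divr_ge0 // ltW.
    by have := sqr_ge0 (2 * y - 1); nra.
  have wk k : `|f y - f (k%:R / n%:R)| <= w k.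
    have [ykd|dyk] := ltP `|y - k%:R / n%:R| d.
      apply: (le_trans (ltW (hd _ ykd))); rewrite lerDl.
      by rewrite mulr_ge0 ?sqr_ge0 // divr_ge0 // sqr_ge0.
    apply: (@le_trans _ _ (2 * M)).
      by apply: (le_trans (ler_normB _ _)); have := fM y; have := fM (k%:R / n%:R); lra.
    have -> : w k = e / 2 + 2 * M * (`|y - k%:R / n%:R| / d) ^+ 2.
      rewrite /w /L expr_div_n real_normK ?num_real //; field.
      by rewrite !gt_eqF.
    have q1 : 1 <= `|y - k%:R / n%:R| / d by rewrite ler_pdivlMr // mul1r.
    have : 2 * M * 1 <= 2 * M * (`|y - k%:R / n%:R| / d) ^+ 2.
      by apply: ler_wpM2l; [rewrite mulr_ge0 | rewrite exprn_ege1].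
    by lra.
  have := @bernstein_affine y n (f y) (-1) (fun k => f (k%:R / n%:R)).
  set B := bernstein y n (fun k => f _) => hB.
  have up : bernstein y n (fun k => f y + -1 * f (k%:R / n%:R)) <= bernstein y n w.
    apply: le_bernstein => // k; have := wk k; rewrite ler_norml => /andP[_]; lra.
  have dn : bernstein y n (fun k => 0 + -1 * w k)
      <= bernstein y n (fun k => f y + -1 * f (k%:R / n%:R)).
    apply: le_bernstein => // k; have := wk k; rewrite ler_norml => /andP[+ _]; lra.
  rewrite bernstein_affine in dn.
  by rewrite ler_norml; apply/andP; split; lra.
near=> n.
have n0 : (0 < n)%N by near: n; exact: nbhs_infty_gt.
have n0' : 0 < n%:R :> R by rewrite ltr0n.
apply: (le_lt_trans (bound n n0)).
have : 2 * L / e < n%:R by near: n; exact: nbhs_infty_gtr.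
rewrite ltr_pdivrMr // => h.
have : L / n%:R < e / 2 by rewrite ltr_pdivrMr //; lra.
by lra.
Unshelve. all: by end_near.
Qed.

Lemma sine_poly_bernstein (h : R -> R) n g : sine_poly h ->
  sine_poly (fun x => h x * bernstein ((1 + cos x) / 2) n g).
Proof.
move=> hh; elim: n g => [|n IH] g /=.
  rewrite (_ : (fun x => _) = fun x => g 0%N * h x); first exact: sine_polyZ.
  by apply/funext => x; rewrite mulrC.
pose u (g : nat -> R) x := h x * bernstein ((1 + cos x) / 2) n g.
pose gS k := g k.+1.
rewrite (_ : (fun x => _) = fun x =>
  2^-1 * ((u g x + -1 * (cos x * u g x)) + (u gS x + cos x * u gS x))).
  apply: sine_polyZ; apply: sine_polyD; apply: sine_polyD; try exact: IH.
    by apply: sine_polyZ; apply: sine_poly_cos; exact: IH.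
  by apply: sine_poly_cos; exact: IH.
by apply/funext => x; rewrite /u /gS; field.
Qed.

End Bernstein.

Lemma cvge0_exists_lt (R : realType) (v : nat -> \bar R) (c : R) :
  v @ \oo --> 0%E -> 0 < c -> exists n, (v n < c%:E)%E.
Proof.
move=> v0 c0; have c0' : (0 < c%:E)%E by rewrite lte_fin.
have [n _ hn] := v0 _ (open_ereal_lt' c0').
by exists n; exact: hn n (leqnn n).
Qed.

Section SineComplete.
Context {R : realType}.
Let mu : measure _ _ := @lebesgue_measure R.
Let D : set R := `]0, pi[%classic.
Let mD : measurable D. Proof. exact: measurable_itv. Qed.
Let muD : (mu D < +oo)%E.
Proof.
have -> : mu D = pi%:E.
  rewrite (_ : mu D = (@lebesgue_measure R) `]0, pi[%classic) //.
  by rewrite lebesgue_measure_itv /= lte_fin pi_gt0 oppr0 adde0.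
exact: ltry.
Qed.

Lemma l2n_dominated (u : nat -> R -> R) (w : R -> R) :
  (forall n, measurable_fun D (u n)) -> mu.-integrable D (EFin \o w) ->
  (forall n x, x \in `]0, pi[ -> u n x ^+ 2 <= w x) ->
  (forall x, x \in `]0, pi[ -> u n x @[n --> \oo] --> 0) ->
  forall e, 0 < e -> exists n, in_L2 (u n) /\ l2n (u n) < e.
Proof.
move=> mu_ iw uw u0 e e0.
have mu2 n : measurable_fun D (fun x => (u n x ^+ 2)%:E).
  by apply/measurable_EFinP; exact: measurable_funX.
have cv : ((\int[mu]_(x in D) (u n x ^+ 2)%:E) @[n --> \oo]
    --> \int[mu]_(x in D) (cst 0 x)%:E)%E.
  apply: (@dominated_cvg _ _ R mu D mD (fun n x => (u n x ^+ 2)%:E)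
    (fun x => (cst 0 x)%:E) (EFin \o w)) => //.
  - move=> x xD; apply: cvg_EFin; first exact: nearW.
    have := cvgM (u0 x xD) (u0 x xD); rewrite mulr0; exact.
  - by move=> n x xD; rewrite gee0_abs ?lee_fin ?sqr_ge0 //; exact: uw.
rewrite integral0_eq // in cv.
have e4 : 0 < (e / 2) ^+ 2 by rewrite exprn_gt0 // divr_gt0.
have [n hn] : exists n, (\int[mu]_(x in D) (u n x ^+ 2)%:E <= ((e / 2) ^+ 2)%:E)%E.
  by have [n hn] := cvge0_exists_lt cv e4; exists n; exact: ltW.
exists n; have e2 : 0 <= e / 2 by rewrite divr_ge0 // ltW.
have [Lu lu] := in_L2_sqr_le (mu_ n) e2 hn.
by split => //; apply: (le_lt_trans lu); lra.
Qed.

Let clip (M t : R) : R := Num.max (- M) (Num.min t M).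

Let clip_norm M t : 0 <= M -> `|clip M t| <= M.
Proof.
move=> M0; rewrite ler_norml /clip le_max lexx /= ge_max ge_min lexx orbT andbT.
by lra.
Qed.

Let clip_dist M s t : `|s| <= M -> `|s - clip M t| <= `|s - t|.
Proof.
rewrite ler_norml => /andP[s1 s2]; rewrite /clip /Num.min; case: ltP => h1;
 rewrite /Num.max; case: ltP => h2; rewrite ?ler_norml;
 by case: (ger0P (s - t)) => h; apply/andP; split; lra.
Qed.

Let clip_continuous M (h : R -> R) : continuous h -> continuous (fun x => clip M (h x)).
Proof.
move=> ch x.
apply: (@continuous_max R R (fun=> - M) (fun x => Num.min (h x) M) x).
  exact: cst_continuous.
apply: (@continuous_min R R h (fun=> M) x); first exact: ch.
exact: cst_continuous.
Qed.

Let sin_pos (x : R) : x \in `]0, pi[ -> 0 < sin x.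
Proof. by rewrite in_itv; exact: sin_gt0_pi. Qed.

Lemma sine_poly_approx_bounded_continuous (h : R -> R) (M e : R) :
  continuous h -> (forall x, `|h x| <= M) -> 0 < e ->
  exists s, sine_poly s /\ l2n (fun x => sin x * h x - s x) < e.
Proof.
move=> ch hM e0.
have M0 : 0 <= M by exact: le_trans (hM 0).
(* [h] read in the variable y = (1 + cos x) / 2. As [h] is bounded everywhere, so is [f], whatever
   [acos] is outside [-1, 1]. *)
pose f t := h (acos (2 * t - 1)).
pose y (x : R) := (1 + cos x) / 2.
pose s n x := sin x * bernstein (y x) n (fun k => f (k%:R / n%:R)).
have ss n : sine_poly (s n).
  apply: sine_poly_bernstein; have := @sine_poly_sine R 1.
  by congr sine_poly; apply/funext => x; rewrite /sine mul1r.
have y01 x : 0 <= y x /\ y x <= 1.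
  by have := cos_le1 x; have := cos_geN1 x; rewrite /y; split; lra.
have csin : continuous (fun x => sin x * h x).
  by move=> x; apply: cvgM; [exact: continuous_sin | exact: ch].
have mu_ n : measurable_fun D (fun x => sin x * h x - s n x).
  apply: measurable_funTS; apply: continuous_measurable_fun => x.
  by apply: cvgB; [exact: csin | exact: continuous_sine_poly].
have [n [_ hn]] : exists n, in_L2 (fun x => sin x * h x - s n x) /\
    l2n (fun x => sin x * h x - s n x) < e; last by exists (s n).
apply: (l2n_dominated mu_ (w := fun=> (2 * M) ^+ 2)) => //.
- apply: measurable_bounded_integrable => //.
  exists `|(2 * M) ^+ 2|; split; first exact: num_real.
  by move=> t ht x _; exact: ltW.
- move=> n x xD; rewrite -mulrBr.
  have : `|sin x * (h x - bernstein (y x) n (fun k => f (k%:R / n%:R)))| <= 2 * M.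
    rewrite normrM; apply: (@le_trans _ _ (1 * (M + M))); last by rewrite mul1r; lra.
    apply: ler_pM => //; first exact: sin_max.
    apply: (le_trans (ler_normB _ _)); apply: lerD => //.
    by have [? ?] := y01 x; apply: bernstein_norm_le => // k; exact: hM.
  move=> H; rewrite -real_normK ?num_real // lerXn2r ?nnegrE //.
  by rewrite mulr_ge0.
- move=> x xD; rewrite /s.
  have H : bernstein (y x) n (fun k => f (k%:R / n%:R)) @[n --> \oo] --> f (y x).
    have [? ?] := y01 x; apply: (@bernstein_cvg _ f (y x) M) => //.
      by move=> t; exact: hM.
    have E : 2 * y x - 1 = cos x by rewrite /y; field.
    have cx : -1 < cos x < 1.
      have [x0 xpi] : 0 < x /\ x < pi by move: xD; rewrite in_itv => /andP.
      have p0 := pi_gt0 R.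
      have cc t : 0 <= t -> t <= pi -> t \in `[0, pi : R].
        by move=> ? ?; rewrite in_itv; apply/andP.
      rewrite -{1}cospi -(cos0 R).
      by rewrite !ltr_cos ?x0 ?xpi ?cc // ltW.
    have ca : {for y x, continuous (fun t : R => acos (2 * t - 1))}.
      apply: (@continuous_comp R R R (fun t : R => 2 * t - 1) (@acos R) (y x)).
        apply: cvgB; last exact: cvg_cst.
        by apply: cvgM; [exact: cvg_cst | exact: cvg_id].
      by rewrite /prop_for E; exact: continuous_acos.
    exact: (@continuous_comp R R R (fun t : R => acos (2 * t - 1)) h (y x) ca (ch _)).
  have fy : f (y x) = h x.
    rewrite /f (_ : 2 * y x - 1 = cos x); last by rewrite /y; field.
    by rewrite cosK //; exact: subset_itv_oo_cc xD.
  rewrite -(subrr (sin x * h x)); apply: cvgB; first exact: cvg_cst.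
  by apply: cvgM; [exact: cvg_cst | rewrite -fy].
Qed.

(** A continuous L^1 approximant, clipped to [-M, M], is no farther from [G]. The difference is then
    bounded by 2 M, so its square is controlled by the L^1 distance. *)
Lemma sine_poly_approx_bounded (G : R -> R) (M e : R) : measurable_fun D G ->
  (forall x, `|G x| <= M) -> 0 < e ->
  exists s, sine_poly s /\ l2n (fun x => sin x * G x - s x) < e.
Proof.
move=> mG GM e0.
have M0 : 0 <= M by exact: le_trans (GM 0).
have iG : mu.-integrable D (EFin \o G).
  apply: measurable_bounded_integrable => //.
  exists M; split; first exact: num_real.
  by move=> t ht x _; apply: (le_trans (GM x)); exact: ltW.
have [g [cg ig gG]] := approximation_continuous_integrable mD muD iG.
(* The extra 1 keeps the denominator positive when M = 0. *)
pose eta := (e / 2) ^+ 2 / (2 * M + 1).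
have M1 : 0 < 2 * M + 1 by lra.
have eta0 : 0 < eta by rewrite divr_gt0 // exprn_gt0 // divr_gt0.
have [n hn] := cvge0_exists_lt gG eta0.
pose h x := clip M (g n x).
have ch : continuous h by apply: clip_continuous; exact: cg.
have hM x : `|h x| <= M by exact: clip_norm.
have mh : measurable_fun D h by apply: measurable_funTS; exact: continuous_measurable_fun.
have mg : measurable_fun D (g n).
  by apply: measurable_funTS; exact: continuous_measurable_fun.
have e2 : 0 < e / 2 by rewrite divr_gt0.
have msin : measurable_fun D (@sin R).
  by apply: measurable_funTS; apply: continuous_measurable_fun; exact: continuous_sin.
have md : measurable_fun D (fun x => sin x * (G x - h x)).
  by apply: measurable_funM => //; exact: measurable_funB.
have [Ld ld] : in_L2 (fun x => sin x * (G x - h x)) /\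
    l2n (fun x => sin x * (G x - h x)) <= e / 2.
  apply: in_L2_sqr_le => //; first exact: ltW.
  apply: (@le_trans _ _ (\int[mu]_(x in D) ((2 * M + 1)%:E * `|(G x - g n x)%:E|))%E).
    apply: ge0_le_integral => //.
    - by move=> x _; rewrite lee_fin sqr_ge0.
    - by apply/measurable_EFinP; exact: measurable_funX.
    - apply/measurable_EFinP; apply: measurable_funM; first exact: measurable_cst.
      by apply: measurableT_comp => //; exact: measurable_funB.
    - move=> x _; rewrite -EFinM lee_fin -real_normK ?num_real // expr2.
      have h1 : `|sin x * (G x - h x)| <= `|G x - h x|.
        by rewrite normrM ler_piMl // sin_max.
      apply: ler_pM => //.
        apply: (le_trans h1); apply: (le_trans (ler_normB _ _)).
        by have := GM x; have := hM x; lra.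
      by apply: (le_trans h1); exact: clip_dist.
  rewrite ge0_integralZl_EFin //; last 2 first.
  - apply/measurable_EFinP; apply: measurableT_comp => //; exact: measurable_funB.
  - exact: ltW.
  apply: (@le_trans _ _ ((2 * M + 1)%:E * eta%:E)%E).
    by apply: lee_wpmul2l; [rewrite lee_fin ltW | exact: ltW].
  by rewrite -EFinM lee_fin /eta mulrC divfK // gt_eqF.
have [s [ss hs]] := sine_poly_approx_bounded_continuous ch hM e2.
exists s; split => //.
have Lsh : in_L2 (fun x => sin x * h x - s x).
  apply: in_L2_continuous => x.
  apply: cvgB; last exact: continuous_sine_poly.
  by apply: cvgM; [exact: continuous_sin | exact: ch].
rewrite (_ : (fun x => _) = fun x => sin x * (G x - h x) + (sin x * h x - s x)).
  by apply: (le_lt_trans (l2nD Ld Lsh)); lra.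
by apply/funext => x; ring.
Qed.

(** The quotient g / sin may be unbounded, so it is clipped at height n. Clipping gives |t - clip t|
    <= |t|, so g^2 dominates the squared error. *)
Lemma sine_complete : complete_system (@sine R).
Proof.
move=> g Lg e e0.
have mg : measurable_fun D g by case/in_L2P : Lg.
have e2 : 0 < e / 2 by rewrite divr_gt0.
have msin : measurable_fun D (@sin R).
  by apply: measurable_funTS; apply: continuous_measurable_fun; exact: continuous_sin.
pose G (n : nat) x := clip n%:R (g x / sin x).
have mG n : measurable_fun D (G n).
  apply: (@measurable_maxr _ _ _ _ (fun=> - n%:R) (fun x => Num.min (g x / sin x) n%:R)).
    exact: measurable_cst.
  apply: (@measurable_minr _ _ _ _ (fun x => g x / sin x) (fun=> n%:R)); last first.
    exact: measurable_cst.
  apply: measurable_funM => //.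
  apply: open_continuous_measurable_fun; first exact: interval_open.
  move=> x; rewrite inE /= => xD.
  by apply: continuousV; [rewrite gt_eqF // sin_pos | exact: continuous_sin].
have md n : measurable_fun D (fun x => g x - sin x * G n x).
  by apply: measurable_funB => //; exact: measurable_funM.
have [n [Ln hn]] : exists n, in_L2 (fun x => g x - sin x * G n x) /\
    l2n (fun x => g x - sin x * G n x) < e / 2.
  apply: (l2n_dominated md (w := fun x => g x ^+ 2)) => //.
  - apply/integrableP; split; first by apply/measurable_EFinP; exact: measurable_funX.
    apply: (@le_lt_trans _ _ (\int[mu]_(x in D) (g x ^+ 2)%:E)%E).
      rewrite le_eqVlt; apply/orP; left; apply/eqP; apply: eq_integral => x _.
      by rewrite gee0_abs // lee_fin sqr_ge0.
    by rewrite -L2_norm_sqr l2nE // -EFin_expe ltry.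
  - move=> n x xD; have s0 := sin_pos xD.
    have E : g x = sin x * (g x / sin x) by field; rewrite gt_eqF.
    rewrite /G; move: E; move: (g x / sin x) => t ->.
    rewrite -mulrBr !exprMn; apply: ler_wpM2l; first exact: sqr_ge0.
    rewrite -(real_normK (num_real (_ - _))) -(real_normK (num_real t)).
    rewrite lerXn2r ?nnegrE //.
    have n0 : 0 <= n%:R :> R by [].
    rewrite /clip /Num.min; case: ltP => h1; rewrite /Num.max; case: ltP => h2;
      case: (ger0P t) => h; rewrite ler_norml; apply/andP; split; lra.
  - move=> x xD; have s0 := sin_pos xD.
    apply/cvgrPdist_lt => d d0; near=> n.
    have h : `|g x / sin x| < n%:R by near: n; exact: nbhs_infty_gtr.
    have -> : G n x = g x / sin x.
      rewrite /G /clip; move: h; rewrite ltr_norml => /andP[h1 h2].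
      by rewrite (min_idPl (ltW h2)) (max_idPr (ltW h1)).
    have -> : g x - sin x * (g x / sin x) = 0 by field; rewrite gt_eqF.
    by rewrite subrr normr0.
have GM x : `|G n x| <= n%:R by exact: clip_norm.
have [s [ss hs]] := sine_poly_approx_bounded (mG n) GM e2.
have [N [a sE]] := ss; exists N, a.
have Ls : in_L2 s by apply: in_L2_continuous; exact: continuous_sine_poly.
have LG : in_L2 (fun x => sin x * G n x).
  have := in_L2B Lg Ln; congr in_L2; apply/funext => x; ring.
rewrite (_ : (fun x => _) = fun x => (g x - sin x * G n x) + (sin x * G n x - s x)).
  have Lr := in_L2B LG Ls.
  rewrite l2nE; last exact: in_L2D.
  by rewrite lte_fin; apply: (le_lt_trans (l2nD Ln Lr)); lra.
by apply/funext => x; rewrite -sE; ring.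
Unshelve. all: by end_near.
Qed.

End SineComplete.

(** * Conclusion *)

(* The left-hand side is minus the derivative of [x `^ - eps] at [k + 1]. *)
Lemma powR_telescope (R : realType) (eps : R) (k : nat) : 0 < eps -> (0 < k)%N ->
  eps * riemannR (1 + eps) k <= (k%:R `^ eps)^-1 - (k.+1%:R `^ eps)^-1.
Proof.
move=> e0 k0.
have k0' : 0 < k%:R :> R by rewrite ltr0n.
have k1 : 0 < k.+1%:R :> R by [].
have p0 : 0 < k%:R `^ eps by rewrite powR_gt0.
have p1 : 0 < k.+1%:R `^ eps by rewrite powR_gt0.
rewrite /riemannR powRD; last by rewrite (gt_eqF k1) implybT.
rewrite powRr1 ?ler0n //.
(* That is, (1 + 1 / k)^eps >= 1 + eps / (k + 1). It follows from exp u >= 1 + u and ln (1 + 1 / k)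
   = - ln (1 - 1 / (k + 1)) >= 1 / (k + 1). *)
have ineq : k%:R `^ eps * (1 + eps / k.+1%:R) <= k.+1%:R `^ eps.
  have -> : k.+1%:R `^ eps = k%:R `^ eps * (k.+1%:R / k%:R) `^ eps.
    rewrite -powRM ?divr_ge0 ?ler0n //; congr (_ `^ _).
    by rewrite mulrC divfK // gt_eqF.
  rewrite ler_pM2l //.
  have q0 : 0 < k.+1%:R / k%:R :> R by rewrite divr_gt0.
  rewrite /powR (gt_eqF q0); apply: (le_trans _ (expR_ge1Dx _)).
  rewrite lerD2l ler_pM2l //.
  have r0 : 0 < k%:R / k.+1%:R :> R by rewrite divr_gt0.
  have := @le_ln1Dx R (k%:R / k.+1%:R - 1).
  have -> : 1 + (k%:R / k.+1%:R - 1) = k%:R / k.+1%:R :> R by ring.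
  have -> : k%:R / k.+1%:R - 1 = - k.+1%:R^-1 :> R.
    by rewrite -natr1; field; rewrite natr1 gt_eqF.
  have -> : ln (k.+1%:R / k%:R) = - ln (k%:R / k.+1%:R) :> R.
    by rewrite -lnV ?posrE // invf_div.
  move=> h; rewrite lerNr; apply: h.
  rewrite ltrN2 invf_lt1 // -natr1; lra.
rewrite -subr_ge0.
have -> : (k%:R `^ eps)^-1 - (k.+1%:R `^ eps)^-1 - eps * (k.+1%:R * k.+1%:R `^ eps)^-1
  = (k.+1%:R `^ eps - k%:R `^ eps * (1 + eps / k.+1%:R))
    / (k%:R `^ eps * k.+1%:R `^ eps).
  by field; rewrite [1 + _]addrC natr1 !gt_eqF.
by rewrite divr_ge0 ?subr_ge0 // mulr_ge0 // ltW.
Qed.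

Lemma is_cvg_riemannR (R : realType) (eps : R) : 0 < eps ->
  cvgn (series (riemannR (1 + eps))).
Proof.
move=> e0; have s0 : 0 <= 1 + eps by lra.
apply: nondecreasing_is_cvgn.
  by apply/nondecreasing_seqP => n; rewrite seriesSr lerDl ltW // riemannR_gt0.
exists (1 + eps^-1) => _ [n _ <-].
have H m : eps * series (riemannR (1 + eps)) m.+1 <= eps + 1 - (m.+1%:R `^ eps)^-1.
  elim: m => [|m IH].
    by rewrite /series /= big_nat1 /riemannR !powR1 invr1; lra.
  rewrite seriesSr mulrDr.
  by have := @powR_telescope R eps m.+1 e0 (ltn0Sn m); lra.
have : eps * series (riemannR (1 + eps)) n <= eps + 1.
  case: n => [|n]; first by rewrite /series /= big_geq // mulr0; lra.
  apply: (le_trans (H n)); rewrite gerBl invr_ge0; exact: powR_ge0.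
rewrite -ler_pdivlMl // => /le_trans; apply.
by rewrite mulrDr mulVf ?gt_eqF // mulr1.
Qed.

Lemma series_le_zeta (R : realType) (eps : R) (n : nat) : 0 < eps ->
  series (riemannR (1 + eps)) n <= zeta (1 + eps).
Proof.
move=> e0; apply: nondecreasing_cvgn_le; last exact: is_cvg_riemannR.
apply/nondecreasing_seqP => m; rewrite seriesSr lerDl ltW // riemannR_gt0 //.
by lra.
Qed.

Lemma zeta_gt1 (R : realType) (eps : R) : 0 < eps -> 1 < zeta (1 + eps).
Proof.
move=> e0; apply: lt_le_trans (series_le_zeta 2 e0).
rewrite seriesSr /series /= big_nat1 {1}/riemannR powR1 invr1 ltrDl riemannR_gt0 //.
by lra.
Qed.

Lemma in_L2_fucik (R : realType) (n : nat) (al be : R) (f : R -> R) :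
  (2 <= n)%N -> fucik_curve n (al, be) -> normalized_fucik_eigenfunction n al be f ->
  in_L2 f /\
  l2n (fun x => f x - sine n x) ^+ 2 <= pi / 2 * (fucik_const n al be *
    ((Num.max (Num.sqrt al) (Num.sqrt be) - n%:R) / n%:R) ^+ 2).
Proof.
move=> n2 curve nf.
have [cf _] := normalized_fucik_explicit n2 curve nf.
have mf : measurable_fun `]0, pi[ f.
  apply: (@measurable_funS _ _ _ _ `[0, pi]%classic) => //.
    exact: subset_itv_oo_cc.
  exact: subspace_continuous_measurable_fun.
have md : measurable_fun `]0, pi[ (fun x => f x - sine n x).
  apply: measurable_funB => //; apply: measurable_funTS.
  by apply: continuous_measurable_fun; exact: continuous_sine.
have := fucik_distance n2 curve nf; rewrite -mulrA.
set B := pi / 2 * _ => hB.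
have B0 : 0 <= B.
  rewrite -lee_fin; apply: (le_trans _ hB); apply: integral_ge0 => x _.
  by rewrite lee_fin sqr_ge0.
have [Ld ld] : in_L2 (fun x => f x - sine n x) /\
    l2n (fun x => f x - sine n x) <= Num.sqrt B.
  by apply: in_L2_sqr_le; rewrite ?sqrtr_ge0 // sqr_sqrtr.
split.
  have := in_L2D Ld (@in_L2_sine R n); congr in_L2; apply/funext => x.
  by rewrite subrK.
rewrite -(sqr_sqrtr B0) lerXn2r // nnegrE; [exact: l2n_ge0 | exact: sqrtr_ge0].
Qed.

(** Dividing n^((1 - eps) / 2) by n and squaring gives n^-(1 + eps), the term of index [n.-1] of
    [riemannR]. *)
Lemma fucik_term_bound (R : realType) (n : nat) (eps c m : R) : (2 <= n)%N ->
  0 <= c -> n%:R <= m -> m <= n%:R + Num.sqrt c * n%:R `^ ((1 - eps) / 2) ->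
  ((m - n%:R) / n%:R) ^+ 2 <= c * riemannR (1 + eps) n.-1.
Proof.
move=> n2 c0 nm mn.
have n0 : 0 < n%:R :> R by rewrite ltr0n ltnW.
have -> : c * riemannR (1 + eps) n.-1
    = (Num.sqrt c * n%:R `^ ((1 - eps) / 2) / n%:R) ^+ 2.
  rewrite !exprMn sqr_sqrtr // -mulrA; congr (_ * _).
  rewrite /riemannR prednK ?(ltnW n2) //.
  have E : n%:R `^ (1 - eps) * n%:R `^ (1 + eps) = n%:R ^+ 2.
    rewrite -powRD; last by rewrite (gt_eqF n0) implybT.
    by rewrite -powR_mulrn ?ler0n //; congr (_ `^ _); ring.
  have -> : (n%:R `^ ((1 - eps) / 2)) ^+ 2 = n%:R `^ (1 - eps).
    by rewrite -powR_mulrn ?powR_ge0 // -powRrM divfK.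
  by rewrite exprVn -E; field; rewrite !gt_eqF ?powR_gt0.
have h0 : 0 <= (m - n%:R) / n%:R by rewrite divr_ge0 ?subr_ge0 // ltW.
have h1 : (m - n%:R) / n%:R <= Num.sqrt c * n%:R `^ ((1 - eps) / 2) / n%:R.
  by rewrite ler_pM2r ?invr_gt0 //; lra.
by rewrite lerXn2r // nnegrE // (le_trans h0).
Qed.

Lemma fucik_const_ge0 (R : realType) (n : nat) (al be : R) : 0 <= fucik_const n al be.
Proof.
rewrite /fucik_const; case: ifP => // _; case: ifP => _.
  apply: divr_ge0; last by apply: exprn_even_ge0.
  by rewrite !mulr_ge0 ?addr_ge0 ?exprn_ge0.
apply: divr_ge0; last by apply: exprn_even_ge0.
by rewrite !mulr_ge0 ?addr_ge0 ?exprn_ge0.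
Qed.

Theorem corollary1p5 (R : realType) (alpha beta : nat -> R)
    (f : nat -> R -> R) (hF : fucik_system alpha beta f)
    (eps : R) (heps : 0 < eps) (c : nat -> R)
    (hc0 : forall n, (2 <= n)%N -> 0 <= c n)
    (hmax : forall n, (2 <= n)%N ->
       Num.max (Num.sqrt (alpha n)) (Num.sqrt (beta n))
         <= n%:R + Num.sqrt (c n) * n%:R `^ ((1 - eps) / 2))
    (hc_even : forall n, (2 <= n)%N -> ~~ odd n ->
       c n < 9 / (8 * (3 + pi ^+ 2)) * (1 / (zeta (1 + eps) - 1)))
    (hc_odd_alpha : forall n, (2 <= n)%N -> odd n -> beta n <= alpha n ->
       c n < (n%:R - 1) ^+ 4 / (8 * n%:R ^+ 2 * (n%:R ^+ 2 + 1))
               * (1 / (zeta (1 + eps) - 1)))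
    (hc_odd_beta : forall n, (2 <= n)%N -> odd n -> alpha n < beta n ->
       c n < (n%:R + 1) ^+ 4 / (10 * n%:R ^+ 2 * (n%:R ^+ 2 + 1))
               * (1 / (zeta (1 + eps) - 1))) :
  riesz_basis f.
Proof.
have [_ _ curve nf] := hF.
set Z := 1 / (zeta (1 + eps) - 1) in hc_even hc_odd_alpha hc_odd_beta.
have z1 : 0 < zeta (1 + eps) - 1 by rewrite subr_gt0 zeta_gt1.
have Z0 : 0 < Z by rewrite divr_gt0.
pose r := riemannR (1 + eps).
have r0 k : 0 < r k by rewrite riemannR_gt0 //; lra.
pose K n := fucik_const n (alpha n) (beta n).
have Kc n : (2 <= n)%N -> K n * c n < Z.
  move=> n2; rewrite /K /fucik_const.
  have n2' : 2 <= n%:R :> R by rewrite ler_nat.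
  have nP : 0 < n%:R :> R by lra.
  have d0 : 0 < n%:R ^+ 2 + 1 :> R by rewrite ltr_wpDl // sqr_ge0.
  have nN0 : n%:R != 0 :> R by rewrite gt_eqF //; lra.
  case: ifP => on.
    have := hc_even n n2 on.
    (* Hence 9 / (3 + pi^2) < 1, and the hypothesis for even n yields 8 c_n < Z. *)
    have p2 : 6 < pi ^+ 2 :> R by have := pi_gt_5half R; nra.
    have -> : 9 / (8 * (3 + pi ^+ 2)) * Z = 9 / (3 + pi ^+ 2) * Z / 8.
      by field; lra.
    have : 9 / (3 + pi ^+ 2) * Z <= 1 * Z.
      by rewrite ler_pM2r // ler_pdivrMr; lra.
    by lra.
  have {}on : odd n by move/negbFE: on.
  have [ba|ab] := leP (beta n) (alpha n).
    have m0 : 0 < n%:R - 1 :> R by lra.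
    have k0 : 0 < 8 * n%:R ^+ 2 * (n%:R ^+ 2 + 1) / (n%:R - 1) ^+ 4 :> R.
      by rewrite divr_gt0 ?exprn_gt0 // !mulr_gt0.
    have := hc_odd_alpha n n2 on ba; rewrite -(ltr_pM2l k0).
    by congr (_ < _); field; rewrite nN0 !gt_eqF.
  have m0 : 0 < n%:R + 1 :> R by lra.
  have k0 : 0 < 10 * n%:R ^+ 2 * (n%:R ^+ 2 + 1) / (n%:R + 1) ^+ 4 :> R.
    by rewrite divr_gt0 ?exprn_gt0 // !mulr_gt0.
  have := hc_odd_beta n n2 on ab; rewrite -(ltr_pM2l k0).
  by congr (_ < _); field; rewrite nN0 !gt_eqF.
pose d n := l2n (fun x => f n x - sine n x).
have f1 x : x \in `]0, pi[ -> f 1%N x = sine 1 x.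
  move=> xI; have := nf 1%N isT; rewrite /normalized_fucik_eigenfunction eqxx.
  by move=> -> //; [rewrite /sine mul1r | exact: subset_itv_oo_cc].
have Lf n : (1 <= n)%N -> in_L2 (f n).
  rewrite leq_eqVlt => /orP[/eqP <-|n2].
    by apply: eq_in_L2 (@in_L2_sine R 1) => x xI; rewrite f1.
  by have [] := in_L2_fucik n2 (curve n n2) (nf n (ltnW n2)).
have d1 : d 1%N = 0.
  rewrite /d /l2n (@eq_L2_norm _ _ (fun=> 0)) ?L2_norm0 // => x xI.
  by rewrite f1 // subrr.
have dn n : (2 <= n)%N -> d n ^+ 2 <= pi / 2 * (K n * c n * r n.-1).
  move=> n2.
  have [_ h] := in_L2_fucik n2 (curve n n2) (nf n (ltnW n2)).
  apply: (le_trans h); rewrite ler_pM2l ?divr_gt0 ?pi_gt0 // -mulrA.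
  apply: ler_wpM2l; first exact: fucik_const_ge0.
  apply: fucik_term_bound => //; [exact: hc0 | | exact: hmax].
  exact: fucik_max_ge (curve n n2).
(* Strict inequalities between terms need not survive an infinite sum, so the term n = 2 keeps its
   exact value: its gap alone gives L < 1, as the bounds Z r_k of all terms add up to Z (zeta - 1) =
   1. *)
pose s2 := K 2%N * c 2%N * r 1%N.
pose L := s2 + Z * (zeta (1 + eps) - 1 - r 1%N).
have ser m : Z * \sum_(2 <= k < m.+2) r k <= Z * (zeta (1 + eps) - 1 - r 1%N).
  rewrite ler_pM2l //; have := @series_le_zeta R eps m.+2 heps.
  rewrite /series /= -/r (@big_cat_nat _ _ _ 2) //= big_nat_recr //= big_nat1.
  by rewrite {1}/r /riemannR powR1 invr1; lra.
have s20 : 0 <= s2.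
  by rewrite /s2 !mulr_ge0 ?fucik_const_ge0 ?hc0 // ltW.
have L0 : 0 <= L.
  have := ser 0%N; rewrite big_geq // mulr0 => h; exact: addr_ge0.
have L1 : L < 1.
  have : s2 < Z * r 1%N by rewrite ltr_pM2r // Kc.
  have -> : L = s2 - Z * r 1%N + Z * (zeta (1 + eps) - 1) by rewrite /L; ring.
  have -> : Z * (zeta (1 + eps) - 1) = 1 by rewrite /Z; field; rewrite gt_eqF.
  by lra.
have sumd m : \sum_(1 <= n < m.+3) d n ^+ 2
    <= pi / 2 * (s2 + Z * \sum_(2 <= k < m.+2) r k).
  elim: m => [|m IH].
    rewrite big_nat_recr //= big_nat1 d1 expr0n add0r big_geq // mulr0 addr0.
    exact: dn.
  rewrite big_nat_recr //= [\sum_(2 <= k < m.+3) r k]big_nat_recr //=.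
  have : d m.+3 ^+ 2 <= pi / 2 * (Z * r m.+2).
    apply: (le_trans (dn m.+3 isT)); rewrite ler_pM2l ?divr_gt0 ?pi_gt0 //.
    by rewrite ler_pM2r // ltW // Kc.
  by rewrite !mulrDr; move: IH; rewrite mulrDr; lra.
apply: (@perturbed_riesz_basis R f (@sine R) (pi / 2) (Num.sqrt L)).
- exact: Lf.
- by move=> n _; exact: in_L2_sine.
- by rewrite divr_gt0 ?pi_gt0.
- exact: sqrtr_ge0.
- by rewrite -sqrtr1 ltr_sqrt.
- exact: l2n_sine_lincomb.
- exact: sine_complete.
- move=> N; rewrite sqr_sqrtr //.
  (* Two more terms are added so that the sum contains n = 2, as [sumd] requires. *)
  apply: (@le_trans _ _ (\sum_(1 <= n < N.+3) d n ^+ 2)).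
    rewrite [leRHS]big_nat_recr //= [X in X + _]big_nat_recr //= -addrA lerDl.
    by apply: addr_ge0; exact: sqr_ge0.
  apply: (le_trans (sumd N)); rewrite ler_pM2l ?divr_gt0 ?pi_gt0 //.
  by rewrite lerD2l ser.
Qed.
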